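(* Let $\mu\in\mathbb R$, $\sigma>0$, let $m,n,r$ be positive integers, let $G'\in\mathcal G_{\mu,\sigma}^{r\times m}$ and $H'\in\mathcal G_{\mu,\sigma}^{n\times r}$ be Gaussian random matrices, let $M\in\mathbb R^{m\times n}$ be a fixed nonzero matrix, and let $G=G'+U$ and $H=H'+V$ for some fixed matrices $U\in\mathbb R^{r\times m}$ and $V\in\mathbb R^{n\times r}$. Let $r(M)=\mathrm{rank}(M)$, $\widehat r=\min\{r,r(M)\}$, $x>0$ and $y\ge 0$. Then $$F_{1/\|(GM)^+\|}(y)\le F(y,M,\sigma)\quad\text{and}\quad F_{1/\|(MH)^+\|}(y)\le F(y,M,\sigma),\qquad F(y,M,\sigma)=2.35\,y\,\sqrt{\widehat r}\,\|M^+\|/\sigma,$$ that is, $$\mathrm{Probability}\{\|P^+\|\ge 2.35\,x\,\sqrt{\widehat r}\,\|M^+\|/\sigma\}\le 1/x$$ for $P=GM$ and for $P=MH$.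
   Context: $\mathcal G_{\mu,\sigma}^{a\times b}$ is the set of $a\times b$ random matrices whose entries are independent real Gaussian random variables with mean $\mu$ and variance $\sigma^2$. $\|\cdot\|$ is the spectral norm, $B^+$ is the Moore–Penrose pseudo-inverse of $B$, and $F_\gamma(y)=\mathrm{Probability}\{\gamma\le y\}$ is the cumulative distribution function of a real random variable $\gamma$. *)

(* Defs.v *)
From HB Require Import structures.
From mathcomp Require Import all_boot all_order all_algebra.
From mathcomp Require Import all_classical all_reals all_analysis.

Set Implicit Arguments.
Unset Strict Implicit.
Unset Printing Implicit Defensive.

Import Order.TTheory GRing.Theory Num.Theory.

Local Open Scope classical_set_scope.
Local Open Scope ring_scope.

(* MathComp's `|A| on matrices is the max norm, hence the definitions below. *)

Definition l2norm (R : realType) (n : nat) (v : 'cV[R]_n) : R :=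
  Num.sqrt (\sum_i v i 0 ^+ 2).

(* For n > 0 this is a genuine supremum (l2norm_mulmx_has_sup); for n = 0 the
   set is empty and the value is 0. *)
Definition spectral_norm (R : realType) (m n : nat) (A : 'M[R]_(m, n)) : R :=
  sup [set l2norm (A *m v) | v in [set v : 'cV[R]_n | l2norm v = 1]].

(* The four Penrose equations.  MathComp's pinvmx is only a one-sided partial
   inverse and is not the Moore-Penrose inverse. *)
Definition penrose (R : realType) (m n : nat)
    (A : 'M[R]_(m, n)) (X : 'M[R]_(n, m)) : Prop :=
  [/\ A *m X *m A = A, X *m A *m X = X,
      (A *m X)^T = A *m X & (X *m A)^T = X *m A].

(* The default value 0 is never used: see mpinvP and mpinv_unique. *)
Definition mpinv (R : realType) (m n : nat) (A : 'M[R]_(m, n)) : 'M[R]_(n, m) :=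
  xget 0 [set X | penrose A X].

Lemma l2norm_mulmx_has_sup (R : realType) (m n : nat) (A : 'M[R]_(m, n)) :
  (0 < n)%N ->
  has_sup [set l2norm (A *m v) | v in [set v : 'cV[R]_n | l2norm v = 1]].
Proof.
case: n A => // n A _; split.
  exists (l2norm (A *m delta_mx 0 0)), (delta_mx 0 0) => //=.
  rewrite /l2norm (bigD1 0) //= big1 => [|i i0]; last first.
    by rewrite mxE (negbTE i0) expr0n.
  by rewrite mxE !eqxx addr0 expr1n sqrtr1.
exists (Num.sqrt (\sum_i (\sum_j `|A i j|) ^+ 2)) => _ [v /= v1 <-].
have vle j : `|v j 0| <= 1.
  rewrite -sqrtr_sqr -v1 ler_wsqrtr // (bigD1 j) //= lerDl.
  by apply: sumr_ge0 => k _; exact: sqr_ge0.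
apply: ler_wsqrtr; apply: ler_sum => i _.
rewrite -(real_normK (num_real _)) lerXn2r ?nnegrE ?sumr_ge0 //.
rewrite mxE (le_trans (ler_norm_sum _ _ _)) //; apply: ler_sum => j _.
by rewrite normrM ler_piMr.
Qed.

Lemma gram_unitmx (R : realType) (m n : nat) (A : 'M[R]_(m, n)) :
  row_free A -> A *m A^T \in unitmx.
Proof.
move=> fA; rewrite -row_free_unit -kermx_eq0; apply/eqP/row_matrixP => i.
rewrite row0; set u := row i _.
have uAA : u *m (A *m A^T) = 0 by rewrite /u -row_mul mulmx_ker row0.
have uA0 : u *m A = 0.
  have q0 : \sum_j (u *m A) 0 j ^+ 2 = 0.
    have : (u *m A *m (u *m A)^T) 0 0 = 0.
      by rewrite trmx_mul mulmxA -(mulmxA u) uAA mul0mx mxE.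
    by rewrite mxE => h; rewrite -[RHS]h; apply: eq_bigr => j _; rewrite [_^T _ _]mxE.
  apply/rowP => j; rewrite [RHS]mxE; apply/eqP; rewrite -sqrf_eq0.
  by apply/eqP/(psumr_eq0P _ q0) => // k _; exact: sqr_ge0.
by apply: (row_free_inj fA); rewrite uA0 mul0mx.
Qed.

Lemma penrose_ex (R : realType) (m n : nat) (A : 'M[R]_(m, n)) :
  exists X, penrose A X.
Proof.
suff H k (C : 'M[R]_(m, k)) (D : 'M[R]_(k, n)) :
    row_free C^T -> row_free D -> exists X, penrose (C *m D) X.
  rewrite -(mulmx_base A); apply: H; last exact: row_base_free.
  by rewrite /row_free mxrank_tr; exact: col_base_full.
move=> /gram_unitmx; rewrite trmxK => uC /gram_unitmx uD.
pose Q := invmx (D *m D^T); pose S := invmx (C^T *m C).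
exists (D^T *m Q *m S *m C^T).
have DD p (Z : 'M[R]_(k, p)) : D *m (D^T *m (Q *m Z)) = Z.
  by rewrite !mulmxA mulmxV // mul1mx.
have CC p (Z : 'M[R]_(k, p)) : S *m (C^T *m (C *m Z)) = Z.
  by rewrite (mulmxA C^T) mulmxA /S mulVmx // mul1mx.
have QT : Q^T = Q by rewrite /Q trmx_inv trmx_mul trmxK.
have ST : S^T = S by rewrite /S trmx_inv trmx_mul trmxK.
split; first by rewrite -!mulmxA DD CC.
- by rewrite -!mulmxA CC DD.
- by rewrite -!mulmxA DD !trmx_mul trmxK ST mulmxA.
- by rewrite -!mulmxA CC !trmx_mul trmxK QT mulmxA.
Qed.

Lemma mpinvP (R : realType) (m n : nat) (A : 'M[R]_(m, n)) :
  penrose A (mpinv A).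
Proof. by have [X AX] := penrose_ex A; exact: (xgetI 0 AX). Qed.

Lemma mpinv_unique (R : realType) (m n : nat) (A : 'M[R]_(m, n)) X :
  penrose A X -> X = mpinv A.
Proof.
move: (mpinv A) (mpinvP A) => Y [YA1 YA2 YA3 YA4] [XA1 XA2 XA3 XA4].
have AXY : A *m X = A *m Y.
  rewrite -{1}YA1 -(mulmxA (A *m Y)) -[LHS]trmxK trmx_mul XA3 YA3.
  by rewrite !mulmxA XA1 YA3.
have XAY : X *m A = Y *m A.
  rewrite -{1}YA1 !mulmxA -(mulmxA (X *m A)) -[LHS]trmxK trmx_mul XA4 YA4.
  by rewrite -!mulmxA (mulmxA A X A) XA1 YA4.
by rewrite -XA2 XAY -mulmxA AXY mulmxA YA2.
Qed.

Section random_matrices.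
Context d (T : measurableType d) (R : realType) (P : probability T R).

Definition mutually_independent (I : finType) (X : I -> {RV P >-> R}) : Prop :=
  forall (J : {set I}) (A : I -> set R), (forall i, measurable (A i)) ->
  P (\bigcap_(i in [set` J]) (X i @^-1` A i)) =
  (\prod_(i in J) P (X i @^-1` A i))%E.

(* normal_prob mu sigma has mean mu and standard deviation sigma.  Laws are
   compared on measurable sets only, since the values of measures on other sets
   carry no meaning. *)
Definition is_gaussian (mu sigma : R) (X : {RV P >-> R}) : Prop :=
  forall A : set R, measurable A -> distribution P X A = normal_prob mu sigma A.

Definition gaussian_mx (mu sigma : R) (a b : nat)
    (G : 'M[{RV P >-> R}]_(a, b)) : Prop :=
  (forall i j, is_gaussian mu sigma (G i j)) /\
  mutually_independent (fun ij : 'I_a * 'I_b => G ij.1 ij.2).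

Definition sample_mx (a b : nat) (G : 'M[{RV P >-> R}]_(a, b)) (w : T) :
    'M[R]_(a, b) :=
  map_mx (fun X : {RV P >-> R} => X w) G.

(* The library's cdf, for a function not bundled with its measurability. *)
Definition cdf_fun (X : T -> R) (y : R) : \bar R := P (X @^-1` `]-oo, y]).

Lemma cdf_funE (X : {RV P >-> R}) (y : R) : cdf_fun X y = cdf X y.
Proof. by []. Qed.

End random_matrices.

(* Main.v *)
Require Import Defs.
From HB Require Import structures.
From mathcomp Require Import all_boot all_order all_algebra.
From mathcomp Require Import all_classical all_reals all_analysis.
From mathcomp Require Import measurable_realfun ring lra.

Set Implicit Arguments.
Unset Strict Implicit.
Unset Printing Implicit Defensive.

Import Order.TTheory GRing.Theory Num.Theory.
Import numFieldNormedType.Exports.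

Local Open Scope classical_set_scope.
Local Open Scope ring_scope.

(* Standardizing the entries turns G into sigma (Z + D) with Z standard
   Gaussian and D fixed, so arbitrary means are harmless.  Put
   k = min(r, rank M).  Choosing k rows of G and k independent vectors in the
   row space of M (the columns of L), and writing K = M L, one gets
   |(G M)^+| <= |M^+| |K B^-1| / sigma with B = (Z + D) K square and almost
   surely invertible.

   For a unit coordinate vector e_i, B^-1 e_i is the cofactor vector c of row i
   divided by det B = (row i of Z + D) . (K c), and c does not depend on row i.
   Given c, det B is a Gaussian variable of standard deviation |K c|, whence
   P(|K B^-1 e_i| >= s) <= sqrt(2/pi) / s.  Rotating the rows of Z, a general
   vector v satisfies P(|K B^-1 v| >= s) <= sqrt(2/pi) |v| / s.

   Now let v be standard Gaussian in R^k and independent of Z.  If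
   |K B^-1| > t, then |K B^-1 v| >= a t with probability at least P(|g| >= a),
   g standard Gaussian, because some row combination of K B^-1 has norm
   above t.  As E|v| <= sqrt k, Fubini gives
   P(|K B^-1| > t) <= sqrt(2/pi) sqrt k / (a P(|g| >= a) t), and for a = 3/4
   the constant is below 2.35.

   Laws of Gaussian families are compared on the sigma-algebra generated by
   rectangles, which also yields rotation invariance and independence of
   disjoint sets of coordinates. *)

(** * Families of independent identically distributed variables *)

Section iid_families.
Context {R : realType} (gam : probability (measurableTypeR R) R).
Implicit Types I : finType.

(** Only rectangles over all of [I] are tested: they are stable under intersection, and since [gam]
    has mass 1 they cover subfamilies too. Any measure [mu] is allowed, so that product measures
    qualify directly. *)
Definition iid_fam I d (T : measurableType d) (mu : {measure set T -> \bar R})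
    (X : T -> I -> R) :=
  (forall i, measurable_fun setT (X ^~ i)) /\
  (forall A : I -> set R, (forall i, measurable (A i)) ->
    mu [set w | forall i, A i (X w i)] = (\prod_i gam (A i))%E).

Definition rects I : set (set (I -> R)) :=
  [set [set f | forall i, A i (f i)] | A in [set A | forall i, measurable (A i)]].

(** The product sigma-algebra on families, presented by generators so that a uniqueness theorem for
    measures can compare laws. *)
Definition fam_space I := g_sigma_algebraType (@rects I).

Lemma rect_measurable I (A : I -> set R) : (forall i, measurable (A i)) ->
  measurable ([set f : fam_space I | forall i, A i (f i)]).
Proof. by move=> mA; apply: sub_sigma_algebra; exists A. Qed.

Lemma measurable_coord I (i : I) :
  measurable_fun setT (fun f : fam_space I => f i : R).
Proof.
move=> _ A mA; rewrite setTI.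
have -> : (fun f : fam_space I => f i : R) @^-1` A =
    [set f : fam_space I | forall j, (if j == i then A else setT) (f j)].
  apply/seteqP; split=> f /= Hf.
    by move=> j; case: eqP => [->|].
  by have := Hf i; rewrite eqxx.
apply: (@rect_measurable _ (fun j => if j == i then A else setT)) => j.
by case: eqP.
Qed.

Lemma measurable_rect_preimage I d (T : measurableType d) (X : T -> I -> R)
    (A : I -> set R) :
  (forall i, measurable_fun setT (X ^~ i)) -> (forall i, measurable (A i)) ->
  measurable [set w | forall i, A i (X w i)].
Proof.
move=> mX mA.
have -> : [set w | forall i, A i (X w i)] =
    \bigcap_(i in setT) ((X ^~ i) @^-1` (A i)).
  by apply/seteqP; split=> w /= Hw i; [move=> _|]; exact: Hw.
apply: fin_bigcap_measurable => // i _.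
by rewrite -[X in measurable X]setTI; exact: mX.
Qed.

Lemma measurable_fam I d (T : measurableType d) (X : T -> I -> R) :
  (forall i, measurable_fun setT (X ^~ i)) ->
  measurable_fun setT (X : T -> fam_space I).
Proof.
move=> mX; apply: (@measurability _ _ T (fam_space I) setT X (@rects I)) => //.
move=> _ [_ [A mA <-] <-].
by rewrite setTI; exact: measurable_rect_preimage.
Qed.

(** Both push-forwards are finite and agree on rectangles, a generating class closed under
    intersection. *)
Lemma iid_fam_law I d1 d2 (T1 : measurableType d1) (T2 : measurableType d2)
    (m1 : {measure set T1 -> \bar R}) (m2 : {measure set T2 -> \bar R})
    (X : T1 -> I -> R) (Y : T2 -> I -> R) (B : set (I -> R)) :
  iid_fam m1 X -> iid_fam m2 Y -> measurable (B : set (fam_space I)) ->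
  m1 (X @^-1` B) = m2 (Y @^-1` B).
Proof.
move=> [mX X_] [mY Y_].
have mX' := measurable_fam mX; have mY' := measurable_fam mY.
pose fX : T1 -> fam_space I := X; pose fY : T2 -> fam_space I := Y.
have rT : @rects I setT.
  by exists (fun=> setT) => //; apply/seteqP; split.
apply: (@g_sigma_algebra_measure_unique _ R (fam_space I) (@rects I) _
  (fun=> setT) _ _ (pushforward m1 fX) (pushforward m2 fY)) => //.
- by move=> _ [A mA <-]; exact: rect_measurable.
- by rewrite bigcup_const.
- move=> _ _ [A mA <-] [A' mA' <-]; exists (fun i => A i `&` A' i).
    by move=> i; exact: measurableI.
  apply/seteqP; split=> f /=.
    by move=> H; split=> i; have [] := H i.
  by move=> [H H'] i; split.
- by move=> _ [A mA <-]; exact: (etrans (X_ A mA) (esym (Y_ A mA))).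
- move=> _; change (m1 setT < +oo)%E.
  have := X_ (fun=> setT) (fun=> measurableT).
  have -> : [set w | forall i, (fun=> setT) i (X w i)] = setT.
    by apply/seteqP; split.
  move=> ->; rewrite big1 ?ltry // => i _; exact: (probability_setT gam).
Qed.

(** Replacing the coordinates outside [J] by an independent copy keeps the law; integration over the
    product then plays the role of conditioning on the coordinates in [J]. *)
Lemma iid_fam_decouple I (J : pred I) d1 d2 (T1 : measurableType d1)
    (T2 : measurableType d2) (P1 : probability T1 R) (P2 : probability T2 R)
    (X : T1 -> I -> R) (Y : T2 -> I -> R) :
  iid_fam P1 X -> iid_fam P2 Y ->
  iid_fam (P1 \x P2)%E (fun z i => if J i then X z.1 i else Y z.2 i).
Proof.
move=> [mX X_] [mY Y_]; split=> [i|A mA].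
  by case: (J i); [exact: (measurableT_comp (mX i))|
                   exact: (measurableT_comp (mY i))].
(* Each factor leaves the coordinates of the other one free, at the price of factors
   [gam setT = 1]. *)
pose A1 i := if J i then A i else setT.
pose A2 i := if J i then setT else A i.
have mA1 i : measurable (A1 i) by rewrite /A1; case: ifP.
have mA2 i : measurable (A2 i) by rewrite /A2; case: ifP.
have -> : [set w : T1 * T2 | forall i, A i (if J i then X w.1 i else Y w.2 i)] =
    [set w | forall i, A1 i (X w i)] `*` [set w | forall i, A2 i (Y w i)].
  apply/seteqP; split=> [[w w'] /= H|[w w'] /= [H H'] i].
    by split=> i; have := H i; rewrite /A1 /A2; case: ifP.
  by have := H i; have := H' i; rewrite /A1 /A2; case: ifP.
rewrite [LHS]product_measure1E; [|exact: measurable_rect_preimage..].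
rewrite X_ // Y_ // -big_split; apply: eq_bigr => i _ /=.
by rewrite /A1 /A2; case: (J i);
   rewrite (probability_setT gam) ?mule1 ?mul1e.
Qed.

(** Coordinates off the image of [h] are left free and contribute mass 1; injectivity makes the
    transported constraint [A'] consistent. This yields rows, columns and submatrices. *)
Lemma iid_fam_comp (I J : finType) (h : J -> I) d (T : measurableType d)
    (mu : {measure set T -> \bar R}) (X : T -> I -> R) :
  injective h -> iid_fam mu X -> iid_fam mu (fun w j => X w (h j)).
Proof.
move=> hi [mX X_]; split=> [j|A mA]; first exact: mX.
pose A' i := if [pick j | h j == i] is Some j then A j else setT.
have mA' i : measurable (A' i) by rewrite /A'; case: pickP.
have A'h j : A' (h j) = A j.
  rewrite /A'; case: pickP => [j' /eqP /hi -> //|/(_ j)].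
  by rewrite eqxx.
have A'N i : i \notin codom h -> A' i = setT.
  rewrite /A'; case: pickP => // j /eqP <-.
  by rewrite codom_f.
have -> : [set w | forall j, A j (X w (h j))] = [set w | forall i, A' i (X w i)].
  apply/seteqP; split=> w /= H i; last by rewrite -A'h.
  have [/codomP[j ->]|/A'N -> //] := boolP (i \in codom h).
  by rewrite A'h.
rewrite X_ // (bigID (mem (codom h))) /= [X in (_ * X)%E]big1 ?mule1; last first.
  by move=> i /A'N ->; exact: (probability_setT gam).
transitivity (\prod_(i <- codom h) gam (A' i))%E.
  by rewrite [RHS]big_uniq // map_inj_uniq // enum_uniq.
by rewrite big_image; apply: eq_big => // j _; rewrite A'h.
Qed.

(** Rotation of the coordinate plane [(p, q)] when [c] and [s] are the cosine and sine of an
    angle. *)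
Definition rot2 I (p q : I) (c s : R) (f : I -> R) (k : I) : R :=
  if k == p then c * f p + s * f q
  else if k == q then - s * f p + c * f q else f k.

(** The condition [s != 0] permits the decomposition of a rotation into shears, which involves
    [(1 - c) / s]. *)
Definition rotation_invariant := forall c s (A B : set R),
  s != 0 -> c ^+ 2 + s ^+ 2 = 1 -> measurable A -> measurable B ->
  (gam \x gam)%E [set z | A (c * z.1 + s * z.2) /\ B (- s * z.1 + c * z.2)] =
  (gam A * gam B)%E.

(** The law of [X] is realized with coordinates [p] and [q] drawn from a separate factor
    [gam \x gam]. There a rotated rectangle is a planar set times a rectangle, and planar invariance
    settles the first factor. *)
Lemma iid_fam_rot2 I (p q : I) c s d (T : measurableType d)
    (P : probability T R) (X : T -> I -> R) :
  rotation_invariant -> p != q -> s != 0 -> c ^+ 2 + s ^+ 2 = 1 ->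
  iid_fam P X -> iid_fam P (fun w => rot2 p q c s (X w)).
Proof.
move=> grot pq s0 cs1 iX; have [mX X_] := iX.
have mrot k : measurable_fun setT (fun f : fam_space I => rot2 p q c s f k : R).
  rewrite /rot2; case: eqP => _; last case: eqP => _; last exact: measurable_coord.
    by apply: measurable_funD; apply: measurable_funM => //; exact: measurable_coord.
  by apply: measurable_funD; apply: measurable_funM => //; exact: measurable_coord.
pose Y (z : (R * R) * T) k :=
  if k == p then z.1.1 else if k == q then z.1.2 else X z.2 k.
have Yprod (B : set (R * R)) A : measurable B -> (forall i, measurable (A i)) ->
    ((gam \x gam) \x P)%E [set z | B z.1 /\
      forall k, k != p -> k != q -> A k (X z.2 k)] =
    ((gam \x gam) B * \prod_(k | (k != p) && (k != q)) gam (A k))%E.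
  move=> mB mA'; pose A' k := if (k == p) || (k == q) then setT else A k.
  have mA'' k : measurable (A' k) by rewrite /A'; case: ifP.
  have -> : [set z : (R * R) * T | B z.1 /\
      forall k, k != p -> k != q -> A k (X z.2 k)] =
      B `*` [set w | forall k, A' k (X w k)].
    apply/seteqP; split=> [[z w] /= [Bz H]|[z w] /= [Bz H]]; split => // k.
      rewrite /A'; case: ifPn => //; rewrite negb_or => /andP[].
      exact: H.
    by move=> kp kq; have := H k; rewrite /A' (negbTE kp) (negbTE kq).
  rewrite [LHS]product_measure1E //; last exact: measurable_rect_preimage.
  congr (_ * _)%E; rewrite X_ // [RHS]big_mkcond; apply: eq_bigr => k _.
  by rewrite /A' -negb_or; case: ifP => //= _; exact: (probability_setT gam).
have prodE A : (\prod_k gam (A k) = gam (A p) * gam (A q) *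
    \prod_(k | (k != p) && (k != q)) gam (A k))%E.
  by rewrite (bigD1 p) //= (bigD1 q) ?muleA // eq_sym.
have iY : iid_fam ((gam \x gam) \x P)%E Y.
  split=> [k|A mA].
    rewrite /Y; case: (k == p); last case: (k == q).
    - exact: measurableT_comp.
    - exact: measurableT_comp.
    - exact: (measurableT_comp (mX k)).
  have -> : [set z | forall k, A k (Y z k)] = [set z | (A p `*` A q) z.1 /\
      forall k, k != p -> k != q -> A k (X z.2 k)].
    apply/seteqP; split=> [z /= H|z /= [[Ap Aq] H] k].
      split=> [|k kp kq]; last by have := H k; rewrite /Y (negbTE kp) (negbTE kq).
      split; first by have := H p; rewrite /Y eqxx.
      by have := H q; rewrite /Y eqxx eq_sym (negbTE pq).
    rewrite /Y; case: eqP => [->//|/eqP kp]; case: eqP => [->//|/eqP kq].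
    exact: H.
  rewrite [LHS]Yprod //; last exact: measurableX.
  rewrite prodE; congr (_ * _)%E.
  by apply: product_measure1E; exact: mA.
split=> [i|A mA].
  exact: (measurableT_comp (mrot i) (measurable_fam mX)).
transitivity (((gam \x gam) \x P)%E
  (Y @^-1` [set f : I -> R | forall k, A k (rot2 p q c s f k)])).
  apply: (iid_fam_law iX iY (B := [set f | forall k, A k (rot2 p q c s f k)])).
  exact: (@measurable_rect_preimage I _ (fam_space I) (rot2 p q c s) A).
have -> : Y @^-1` [set f : I -> R | forall k, A k (rot2 p q c s f k)] =
    [set z | [set z | A p (c * z.1 + s * z.2) /\ A q (- s * z.1 + c * z.2)] z.1
      /\ forall k, k != p -> k != q -> A k (X z.2 k)].
  apply/seteqP; split=> [z /= H|z /= [[Ap Aq] H] k].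
    split=> [|k kp kq]; last first.
      by have := H k; rewrite /rot2 /Y (negbTE kp) (negbTE kq).
    split; first by have := H p; rewrite /rot2 /Y !eqxx eq_sym (negbTE pq).
    by have := H q; rewrite /rot2 /Y !eqxx eq_sym (negbTE pq).
  rewrite /rot2; case: eqP => [->|/eqP kp].
    by rewrite /Y !eqxx eq_sym (negbTE pq).
  case: eqP => [->|/eqP kq]; first by rewrite /Y !eqxx eq_sym (negbTE pq).
  by rewrite /Y (negbTE kp) (negbTE kq); exact: H.
rewrite [LHS]Yprod //; last first.
  apply: measurableI.
    rewrite -[X in measurable X]setTI.
    apply: (measurable_funD (f := fun z : R * R => c * z.1)
      (g := fun z : R * R => s * z.2)) => //; exact: measurable_funM.
  rewrite -[X in measurable X]setTI.
  apply: (measurable_funD (f := fun z : R * R => - s * z.1)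
    (g := fun z : R * R => c * z.2)) => //; exact: measurable_funM.
by rewrite prodE; congr (_ * _)%E; exact: grot.
Qed.

End iid_families.

(** * Gaussian measure on the line and on the plane *)

Section lebesgue_affine.
Context {R : realType}.
Local Notation leb := (@lebesgue_measure R).

(** Uniqueness of Lebesgue measure: the image of [leb] under [x -> a x + b], multiplied by [a],
    gives every half-open interval its length. *)
Lemma lebesgue_measure_affine (a b : R) (A : set R) : 0 < a -> measurable A ->
  leb A = (a%:E * leb [set x | A (a * x + b)%R])%E.
Proof.
move=> a0 mA.
have mf : measurable_fun setT (fun x : measurableTypeR R => a * x + b : measurableTypeR R).
  by apply: measurable_funD => //; exact: measurable_funM.
pose f (x : measurableTypeR R) : measurableTypeR R := a * x + b.
have a0' : 0 <= a by exact: ltW.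
apply: (lebesgue_measure_unique (mu := mscale (NngNum a0') (pushforward leb f))) => //.
move=> _ [[c e]] _ <-.
pose J : set R := `](c - b) / a, (e - b) / a]%classic.
have fE : J = f @^-1` `]c, e].
  apply/seteqP; split=> x; rewrite /J /= !in_itv /= ltr_pdivrMr // ler_pdivlMr //;
    by rewrite ltrBlDr lerBrDr (mulrC x).
transitivity (a%:E * leb J)%E; last by rewrite fE.
rewrite /J !lebesgue_measure_itv /= !lte_fin ltr_pM2r ?invr_gt0 // ltrD2r.
case: ifP => _; last by rewrite mule0.
by rewrite -!EFinB -EFinM; congr (_%:E); field; rewrite gt_eqF.
Qed.

Lemma ge0_integral_affine (a b : R) (f : R -> \bar R) : 0 < a ->
  measurable_fun setT f -> (forall x, 0 <= f x)%E ->
  (\int[leb]_x f x = a%:E * \int[leb]_x f (a * x + b)%R)%E.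
Proof.
move=> a0 mf f0.
have mg : measurable_fun setT (fun x : measurableTypeR R => a * x + b : measurableTypeR R).
  by apply: measurable_funD => //; exact: measurable_funM.
pose g (x : measurableTypeR R) : measurableTypeR R := a * x + b.
have a0' : 0 <= a by exact: ltW.
pose m : {measure set (measurableTypeR R) -> \bar R} := pushforward leb g.
transitivity (\int[mscale (NngNum a0') (m mg)]_x f x)%E.
  apply: eq_measure_integral => A mA _.
  exact: lebesgue_measure_affine.
rewrite ge0_integral_mscale //; congr (_ * _)%E.
by rewrite [LHS](ge0_integral_pushforward mg).
Qed.

Lemma ge0_integral_shift (b : R) (f : R -> \bar R) :
  measurable_fun setT f -> (forall x, 0 <= f x)%E ->
  (\int[leb]_x f (x + b)%R = \int[leb]_x f x)%E.
Proof.
move=> mf f0; rewrite [RHS](@ge0_integral_affine 1 b) // mul1e.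
by under [RHS]eq_integral do rewrite mul1r.
Qed.

End lebesgue_affine.

(** * Integration against the Gaussian density *)

Section gaussian_line.
Context {R : realType}.
Local Notation leb := (@lebesgue_measure R).

Lemma measurable_subgraph (f : R -> R) : measurable_fun setT f ->
  measurable [set z : R * R | 0 <= z.2 /\ z.2 < f z.1].
Proof.
move=> mf.
have -> : [set z : R * R | 0 <= z.2 /\ z.2 < f z.1] =
    (snd @^-1` `[0, +oo[) `&`
    ((fun z => f z.1 - z.2) @^-1` `]0, +oo[).
  by apply/seteqP; split=> z /=; rewrite !in_itv /= !andbT subr_gt0.
apply: measurableI; rewrite -[X in measurable X]setTI.
  exact: (measurable_snd (T1 := R) (T2 := R)).
have mg : measurable_fun setT (fun z : R * R => f z.1 - z.2).
  by apply: measurable_funB => //; exact: measurableT_comp.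
exact: mg.
Qed.

(* The layer-cake formula reduces the claim to indicators, for which the
   density is the definition of the measure. *)
Lemma ge0_integral_normal_prob (m s : R) (f : R -> R) :
  measurable_fun setT f -> (forall x, 0 <= f x) ->
  (\int[normal_prob m s]_x (f x)%:E =
   \int[leb]_x (f x * normal_pdf m s x)%:E)%E.
Proof.
move=> mf f0; pose S := [set z : R * R | 0 <= z.2 /\ z.2 < f z.1].
have mS : measurable S by exact: measurable_subgraph.
have fE x : (f x)%:E = (\int[leb]_t (\1_S (x, t))%:E)%E.
  transitivity (leb `[0, f x[%classic).
    rewrite lebesgue_measure_itv /= lte_fin; case: ltgtP (f0 x) => //.
      by rewrite sube0.
    by move=> <-.
  rewrite (_ : (fun t => _) = (fun t => (\1_(`[0%R, f x[%classic : set R) t)%:E)).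
    by rewrite integral_indic // setIT.
  apply/funext => t; rewrite !indicE.
  rewrite (_ : ((x, t) \in S) = (t \in (`[0%R, f x[%classic : set R))) //.
  by apply/idP/idP; rewrite !inE /= in_itv /= => /andP.
pose pdf x := normal_pdf m s x.
have mpdf : measurable_fun setT pdf by exact: measurable_normal_pdf.
have pdf0 x : 0 <= pdf x by exact: normal_pdf_ge0.
have mind : measurable_fun setT (fun z : R * R => (\1_S z)%:E : \bar R).
  by apply/measurable_EFinP; exact: measurable_indic.
under eq_integral do rewrite fE.
rewrite (fubini_tonelli (m1 := normal_prob m s) (m2 := leb)
  (fun z : R * R => (\1_S z)%:E)) //.
transitivity (\int[leb]_t \int[leb]_x ((\1_S (x, t))%:E * (pdf x)%:E))%E.
  apply: eq_integral => t _.
  have mSt : measurable [set x | S (x, t)].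
    rewrite (_ : [set x | S (x, t)] = ysection S t); first exact: measurable_ysection.
    by apply/seteqP; split=> x; rewrite /ysection /= inE.
  rewrite (_ : (fun x => (\1_S (x, t))%:E) =
      (fun x => (\1_[set x | S (x, t)] x)%:E)); last first.
    by apply/funext => x; rewrite !indicE.
  rewrite integral_indic // setIT /normal_prob [LHS]integral_mkcond.
  apply: eq_integral => x _; rewrite patchE indicE.
  rewrite (_ : ((x, t) \in S) = (x \in [set x | S (x, t)])) //.
  by case: ifP => _; rewrite ?mul1e ?mul0e.
have mprod : measurable_fun setT
    (fun z : R * R => (\1_S z)%:E * (pdf z.1)%:E : \bar R)%E.
  apply: emeasurable_funM => //; apply/measurable_EFinP.
  exact: (measurableT_comp mpdf).
rewrite -(fubini_tonelli (m1 := leb) (m2 := leb)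
  (fun z : R * R => (\1_S z)%:E * (pdf z.1)%:E)%E) //; last first.
  by move=> z; rewrite mule_ge0 // lee_fin.
apply: eq_integral => x _ /=; rewrite ge0_integralZr // ?lee_fin //.
- by rewrite -fE -EFinM.
- exact: (measurableT_comp mind (pair1_measurable x)).
Qed.

End gaussian_line.

(** * The Gaussian measure on the plane and its rotations *)

Section gaussian_plane.
Context {R : realType}.
Local Notation leb := (@lebesgue_measure R).

Lemma normal_probE (m s : R) (A : set R) : measurable A ->
  normal_prob m s A = (\int[leb]_x ((\1_A x)%:E * (normal_pdf m s x)%:E))%E.
Proof.
move=> mA; rewrite /normal_prob integral_mkcond.
apply: eq_integral => x _; rewrite patchE indicE.
by case: ifP => _; rewrite ?mul1e ?mul0e.
Qed.

Lemma normal_prob_prodE (m s : R) (S : set (R * R)) : measurable S ->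
  (normal_prob m s \x normal_prob m s)%E S =
  (\int[leb]_x \int[leb]_y
    ((\1_S (x, y))%:E * (normal_pdf m s x * normal_pdf m s y)%:E))%E.
Proof.
move=> mS; pose gam : probability (measurableTypeR R) R := normal_prob m s.
have mSx x : measurable (xsection S x) by exact: measurable_xsection.
have fin x : gam (xsection S x) \is a fin_num by apply: fin_num_measure; exact: mSx.
have mg : measurable_fun setT (fun x => fine (gam (xsection S x))).
  apply: measurableT_comp => //; exact: measurable_fun_xsection.
(* The density formula concerns real-valued functions, hence the passage through [fine]. *)
transitivity (\int[normal_prob m s]_x (fine (gam (xsection S x)))%:E)%E.
  by apply: eq_integral => x _; rewrite fineK.
rewrite ge0_integral_normal_prob //; last by move=> x; exact: fine_ge0.
apply: eq_integral => x _.
rewrite EFinM fineK // [gam _]normal_probE // -ge0_integralZr //; last 3 first.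
- apply: emeasurable_funM; apply/measurable_EFinP; last exact: measurable_normal_pdf.
  by apply: measurable_indic; exact: mSx.
- by move=> y _; rewrite mule_ge0 ?lee_fin ?normal_pdf_ge0.
- by rewrite lee_fin normal_pdf_ge0.
apply: eq_integral => y _; rewrite -muleA -EFinM (mulrC (normal_pdf m s y)).
rewrite EFinM !indicE (_ : (y \in xsection S x) = ((x, y) \in S)) //.
by rewrite /xsection /= mem_setE.
Qed.

Lemma fubini_tonelli_leb (g : R * R -> \bar R) :
  measurable_fun setT g -> (forall z, 0 <= g z)%E ->
  (\int[leb]_x \int[leb]_y g (x, y) = \int[leb]_y \int[leb]_x g (x, y))%E.
Proof. exact: (@fubini_tonelli _ _ _ _ _ leb leb g). Qed.

(** For fixed [y] the shear translates [x]; Tonelli makes [x] the inner variable. *)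
Lemma ge0_integral_shear1 (t : R) (g : R * R -> \bar R) :
  measurable_fun setT g -> (forall z, 0 <= g z)%E ->
  (\int[leb]_x \int[leb]_y g (x + t * y, y)%R =
   \int[leb]_x \int[leb]_y g (x, y))%E.
Proof.
move=> mg g0.
have mh : measurable_fun setT (fun z : R * R => g (z.1 + t * z.2, z.2)).
  apply: (measurableT_comp mg); apply: measurable_fun_pair => //.
  by apply: measurable_funD => //; exact: measurable_funM.
rewrite (fubini_tonelli_leb mg g0).
apply: (etrans (fubini_tonelli_leb mh (fun z => g0 _))).
apply: eq_integral => y _.
rewrite (ge0_integral_shift (t * y) (f := fun x => g (x, y))) //.
exact: (measurableT_comp mg (pair2_measurable y)).
Qed.

Lemma ge0_integral_shear2 (t : R) (g : R * R -> \bar R) :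
  measurable_fun setT g -> (forall z, 0 <= g z)%E ->
  (\int[leb]_x \int[leb]_y g (x, y + t * x)%R =
   \int[leb]_x \int[leb]_y g (x, y))%E.
Proof.
move=> mg g0; apply: eq_integral => x _.
rewrite (ge0_integral_shift (t * x) (f := fun y => g (x, y))) //.
exact: (measurableT_comp mg (pair1_measurable x)).
Qed.

Lemma measurable_fun_lin2 (a b : R) :
  measurable_fun setT (fun z : R * R => a * z.1 + b * z.2).
Proof.
by apply: measurable_funD; apply: measurable_funM.
Qed.

(* A rotation is a product of three shears, each of which preserves Lebesgue
   measure by translation invariance. *)
Lemma ge0_integral_rot (c s : R) (g : R * R -> \bar R) :
  s != 0 -> c ^+ 2 + s ^+ 2 = 1 ->
  measurable_fun setT g -> (forall z, 0 <= g z)%E ->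
  (\int[leb]_x \int[leb]_y g (c * x + s * y, - s * x + c * y)%R =
   \int[leb]_x \int[leb]_y g (x, y))%E.
Proof.
(* The tangent of half the angle: the shears with coefficients [t], [- s], [t] compose to the
   rotation because [1 - s t = c]. *)
move=> s0 cs1 mg g0; pose t := (1 - c) / s.
pose g1 (z : R * R) := g (z.1 + t * z.2, z.2).
have mg1 : measurable_fun setT g1.
  apply: (measurableT_comp mg); apply: measurable_fun_pair => //.
  by apply: measurable_funD => //; exact: measurable_funM.
pose g2 (z : R * R) := g1 (z.1, z.2 + - s * z.1).
have mg2 : measurable_fun setT g2.
  apply: (measurableT_comp mg1); apply: measurable_fun_pair => //.
  by apply: measurable_funD => //; exact: measurable_funM.
apply: etrans (ge0_integral_shear1 t mg g0).
apply: etrans (ge0_integral_shear2 (- s) mg1 (fun z => g0 _)).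
apply: etrans (ge0_integral_shear1 t mg2 (fun z => g0 _)).
apply: eq_integral => x _; apply: eq_integral => y _.
rewrite /g2 /g1 /=; congr (g (_, _)).
  have -> : c * x + s * y = c * x + (c ^+ 2 + s ^+ 2 - c ^+ 2) / s * y.
    by field.
  by rewrite cs1 /t; field.
by rewrite /t; field.
Qed.

(** The product density depends only on [x^2 + y^2], and Lebesgue measure is rotation invariant. *)
Lemma normal_prob_rotation (c s : R) (A B : set R) :
  s != 0 -> c ^+ 2 + s ^+ 2 = 1 -> measurable A -> measurable B ->
  (normal_prob 0 1 \x normal_prob 0 1)%E
    [set z : R * R | A (c * z.1 + s * z.2) /\ B (- s * z.1 + c * z.2)] =
  (normal_prob 0 1 A * normal_prob 0 1 B)%E.
Proof.
move=> s0 cs1 mA mB.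
have mrot : measurable_fun setT
    (fun z : R * R => (c * z.1 + s * z.2, - s * z.1 + c * z.2)).
  by apply: measurable_fun_pair; exact: measurable_fun_lin2.
have mAB : measurable (A `*` B) by exact: measurableX.
pose gam : probability (measurableTypeR R) R := normal_prob 0 1.
have gamAB : (gam \x gam)%E (A `*` B) = (gam A * gam B)%E.
  by apply: product_measure1E; [exact: mA|exact: mB].
apply: etrans gamAB.
have mS : measurable
    [set z : R * R | A (c * z.1 + s * z.2) /\ B (- s * z.1 + c * z.2)].
  rewrite -[X in measurable X]setTI; exact: (mrot measurableT _ mAB).
apply: (etrans (normal_prob_prodE 0 1 mS)).
apply: (etrans _ (esym (normal_prob_prodE 0 1 mAB))).
pose g (z : R * R) := ((\1_(A `*` B) z)%:E *
  (normal_pdf 0 1 z.1 * normal_pdf 0 1 z.2)%:E)%E.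
have mg : measurable_fun setT g.
  apply: emeasurable_funM; apply/measurable_EFinP; first exact: measurable_indic.
  by apply: measurable_funM; apply: (measurableT_comp (measurable_normal_pdf 0 1)).
have g0 z : (0 <= g z)%E by rewrite mule_ge0 // lee_fin // mulr_ge0 ?normal_pdf_ge0.
apply: etrans (ge0_integral_rot s0 cs1 mg g0).
apply: eq_integral => x _; apply: eq_integral => y _.
rewrite /g /=; congr (_ * _%:E)%E.
rewrite !normal_pdfE ?oner_eq0 // mulrACA [RHS]mulrACA; congr (_ * _).
rewrite /normal_fun -!expRD; congr expR; rewrite !subr0 -!mulrDl; congr (_ / _).
rewrite -!opprD; congr (- _).
transitivity ((c ^+ 2 + s ^+ 2) * (x ^+ 2 + y ^+ 2)); first by rewrite cs1 mul1r.
by ring.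
Qed.

End gaussian_plane.

(** * Estimates for one Gaussian variable *)

Section gaussian_estimates.
Context {R : realType}.
Local Notation leb := (@lebesgue_measure R).

(** The set is an interval of length [2 s / |b|] and the density is at most
    [normal_peak 1 = 1 / sqrt (2 pi)]. The bound is uniform in the shift [u], which is why fixed
    perturbations do no harm. *)
Lemma normal_prob_interval (b u s : R) : b != 0 -> 0 <= s ->
  (normal_prob 0 1 [set x : R | `|b * x + u| <= s]%R <=
   (2 * normal_peak 1 * s / `|b|)%:E)%E.
Proof.
move=> b0 s0; have nb : 0 < `|b| by rewrite normr_gt0.
pose J : set R := `[(- u / b) - s / `|b|, (- u / b) + s / `|b|]%classic.
have -> : [set x : R | `|b * x + u| <= s] = J.
  have H x : (`|b * x + u| <= s) = (`|x + u / b| <= s / `|b|).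
    by rewrite ler_pdivlMr // -normrM; congr (`|_| <= _); field.
  apply/seteqP; split=> x; rewrite /J /= in_itv /= H ler_norml mulNr;
    move=> /andP[h1 h2]; apply/andP; split; lra.
have mJ : measurable J by exact: measurable_itv.
rewrite /normal_prob.
apply: (@le_trans _ _ (\int[leb]_(x in J) (normal_peak 1)%:E)%E).
  apply: ge0_le_integral => //.
  - by move=> x _; rewrite lee_fin normal_pdf_ge0.
  - by apply/measurable_EFinP/measurable_funTS; exact: measurable_normal_pdf.
  - by move=> x _; rewrite lee_fin normal_pdf_ub // oner_eq0.
rewrite integral_cst //= /J lebesgue_measure_itv /= lte_fin.
case: ifP => _; last by rewrite mule0 lee_fin !mulr_ge0 ?normal_peak_ge0 ?invr_ge0.
rewrite -EFinB -EFinM lee_fin le_eqVlt; apply/orP; left; apply/eqP.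
by field; rewrite gt_eqF.
Qed.

Lemma normal_prob_standardize (m s : R) (A : set R) : 0 < s -> measurable A ->
  normal_prob m s [set x | A ((x - m) / s)] = normal_prob 0 1 A.
Proof.
move=> s0 mA.
have mB : measurable [set x : R | A ((x - m) / s)].
  have mf : measurable_fun setT (fun x : R => (x - m) / s).
    by apply: measurable_funM => //; exact: measurable_funB.
  by rewrite -[X in measurable X]setTI; exact: mf.
apply: (etrans (normal_probE m s mB)).
apply: (etrans _ (esym (normal_probE 0 1 mA))).
have mf : measurable_fun setT (fun x : R => (\1_A x)%:E * (normal_pdf 0 1 x)%:E)%E.
  apply: emeasurable_funM; apply/measurable_EFinP; last exact: measurable_normal_pdf.
  exact: measurable_indic.
have mg : measurable_fun setT (fun x : R => s^-1 * x + - m / s).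
  by apply: measurable_funD => //; exact: measurable_funM.
have is0 : 0 < s^-1 by rewrite invr_gt0.
have f0 x : (0 <= (\1_A x)%:E * (normal_pdf 0 1 x)%:E :> \bar R)%E.
  by rewrite mule_ge0 ?lee_fin ?normal_pdf_ge0.
apply: (etrans _ (esym (ge0_integral_affine (- m / s) is0 mf f0))).
rewrite -ge0_integralZl //; last 2 first.
- exact: (measurableT_comp mf mg).
- by rewrite lee_fin ltW.
apply: eq_integral => x _.
have -> : s^-1 * x + - m / s = (x - m) / s by rewrite mulNr mulrBl (mulrC x).
rewrite muleCA; congr (_ * _)%E; rewrite -EFinM; congr (_%:E).
rewrite !normal_pdfE ?oner_eq0 ?gt_eqF // mulrA; congr (_ * _).
  rewrite /normal_peak expr1n mul1r -mulrnAr sqrtrM ?sqr_ge0 // sqrtr_sqr.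
  by rewrite gtr0_norm // invfM.
rewrite /normal_fun; congr expR; rewrite subr0; field.
by rewrite gt_eqF.
Qed.

Lemma normal_prob_second_moment :
  (\int[normal_prob 0 1]_x (x ^+ 2)%:E <= 1%:E :> \bar R)%E.
Proof.
have mX2 : measurable_fun setT (fun x : R => x ^+ 2) by exact: measurable_funX.
rewrite (ge0_integral_normal_prob 0 1 mX2) //; last by move=> x; exact: sqr_ge0.
set I := (\int[leb]_x _)%E.
have I0 : (0 <= I)%E.
  by apply: integral_ge0 => x _; rewrite lee_fin mulr_ge0 ?sqr_ge0 ?normal_pdf_ge0.
(* Comparing the N(0,s^2) density with the first-order expansion of
   e^(x^2(1-1/s^2)/2) and letting s decrease to 1. *)
have step s : 1 < s -> (I <= (2 * s ^+ 2 / (s + 1))%:E)%E.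
  move=> s1; have s0 : 0 < s by exact: lt_trans s1.
  pose c := (1 - s ^- 2) / 2.
  have c0 : 0 < c.
    by rewrite divr_gt0 // subr_gt0 invf_lt1 ?exprn_gt0 // exprn_egt1.
  have mpdf : measurable_fun setT (fun x : R => (normal_pdf 0 1 x)%:E).
    by apply/measurable_EFinP; exact: measurable_normal_pdf.
  have mXp : measurable_fun setT (fun x : R => (x ^+ 2 * normal_pdf 0 1 x)%:E).
    apply/measurable_EFinP; apply: measurable_funM => //.
    exact: measurable_normal_pdf.
  (* Integrates the pointwise inequality [f_1(x) (1 + c x^2) <= s f_s(x)], where [f_s] is the
     N(0,s^2) density. *)
  have : (1 + c%:E * I <= s%:E)%E.
    rewrite /I -[X in (X + _)%E](integral_normal_pdf 0 1) -ge0_integralZl //; last 2 first.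
    - by move=> x _; rewrite lee_fin mulr_ge0 ?sqr_ge0 ?normal_pdf_ge0.
    - by rewrite lee_fin ltW.
    rewrite -ge0_integralD //; last 3 first.
    - by move=> x _; rewrite lee_fin normal_pdf_ge0.
    - move=> x _; rewrite mule_ge0 // lee_fin ?(ltW c0) //.
      by rewrite mulr_ge0 ?sqr_ge0 ?normal_pdf_ge0.
    - exact: emeasurable_funM.
    have sE : (s%:E * \int[leb]_x (normal_pdf 0 s x)%:E = s%:E)%E.
      by rewrite integral_normal_pdf mule1.
    rewrite -[leRHS]sE -[leRHS]ge0_integralZl //; last 3 first.
    - by apply/measurable_EFinP; exact: measurable_normal_pdf.
    - by move=> x _; rewrite lee_fin normal_pdf_ge0.
    - by rewrite lee_fin ltW.
    apply: ge0_le_integral => //.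
    - move=> x _; rewrite adde_ge0 ?mule_ge0 ?lee_fin ?normal_pdf_ge0 ?(ltW c0) //.
      by rewrite mulr_ge0 ?sqr_ge0 ?normal_pdf_ge0.
    - by apply: emeasurable_funD => //; exact: emeasurable_funM.
    - apply: emeasurable_funM => //; apply/measurable_EFinP.
      exact: measurable_normal_pdf.
    move=> x _; rewrite -!EFinM -EFinD lee_fin.
    rewrite !normal_pdfE ?oner_eq0 ?gt_eqF // [leRHS]mulrA.
    have -> : s * normal_peak s = normal_peak 1.
      rewrite /normal_peak expr1n mul1r -mulrnAr sqrtrM ?sqr_ge0 // sqrtr_sqr.
      by rewrite gtr0_norm // invfM mulVKf // gt_eqF.
    rewrite [X in _ + X](_ : _ = normal_peak 1 * (c * x ^+ 2 * normal_fun 0 1 x)); last by ring.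
    rewrite -mulrDr ler_wpM2l ?normal_peak_ge0 //.
    have -> : normal_fun 0 s x = normal_fun 0 1 x * expR (c * x ^+ 2).
      rewrite /normal_fun -expRD; congr expR; rewrite /c; field.
      by rewrite gt_eqF.
    rewrite -[X in X + _]mulr1 (mulrC _ (normal_fun _ _ _)) -mulrDr.
    by rewrite ler_wpM2l ?expR_ge0 // expR_ge1Dx.
  case: I I0 => [r| |] //= r0; last by rewrite gt0_muley ?lte_fin // addey.
  rewrite -EFinM -EFinD !lee_fin => h.
  rewrite ler_pdivlMr; last by lra.
  have : c * (2 * s ^+ 2) * r <= (s - 1) * (2 * s ^+ 2).
    by rewrite mulrAC ler_wpM2r; [lra|rewrite mulr_ge0 // sqr_ge0|lra].
  have -> : c * (2 * s ^+ 2) = (s - 1) * (s + 1).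
    by rewrite /c; field; rewrite gt_eqF.
  by rewrite -!mulrA ler_pM2l ?subr_gt0 // (mulrC r).
apply/lee_addgt0Pr => e e0.
(* At [s = 1 + e / 3] the bound [2 s^2 / (s + 1)] is at most [1 + e]. *)
apply: le_trans (step (1 + e / 3) _) _; first by lra.
rewrite -EFinD lee_fin ler_pdivrMr; last by lra.
have e2 : 0 <= e * e by rewrite mulr_ge0 // ltW.
rewrite -subr_ge0 [X in 0 <= X](_ : _ = e + e * e / 9); first by lra.
by field.
Qed.

End gaussian_estimates.

(** * Numerical estimates *)

Section numerics.
Context {R : realType}.

(** Mean value theorem for the difference of the two sides, whose derivative [exp x - (1 + x)] is
    nonnegative. *)
Lemma expR_ge_quadratic (u : R) : 0 <= u -> 1 + u + u ^+ 2 / 2 <= expR u.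
Proof.
move=> u0.
have [x||c] := @MVT_segment R (fun x => expR x - (1 + x + x ^+ 2 / 2))
    (fun x => expR x - (1 + x)) 0 u u0.
- by move=> _; apply: is_derive_eq; rewrite /GRing.scale /=; field.
- apply: continuous_subspaceT => x; apply: differentiable_continuous.
  exact/derivable1_diffP.
rewrite in_itv /= => /andP[c0 _]; rewrite expR0 expr0n /= mul0r !addr0 !subrr subr0.
move=> E; rewrite -subr_ge0 E subr0 mulr_ge0 // subr_ge0.
exact: expR_ge1Dx.
Qed.

Lemma sin_le_id (x : R) : 0 <= x -> sin x <= x.
Proof.
move=> x0.
have [|c] := @MVT_segment R (fun x => x - sin x) (fun x => 1 - cos x) 0 x x0.
- apply: continuous_subspaceT => y; apply: differentiable_continuous.
  exact/derivable1_diffP.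
rewrite in_itv /= => /andP[c0 _]; rewrite sin0 !subr0 => E.
by rewrite -subr_ge0 E mulr_ge0 // subr_ge0 cos_le1.
Qed.

(** [cos x = 1 - 2 sin^2 (x / 2)], and [sin y <= y] for [y >= 0]. *)
Lemma cos_ge_quadratic (x : R) : 0 <= x <= 1 -> 1 - x ^+ 2 / 2 <= cos x.
Proof.
move=> /andP[x0 x1].
have -> : x = (x / 2) *+ 2 by rewrite -mulr_natr divfK.
rewrite cos_mulr2n cos2sin2.
have s0 : 0 <= sin (x / 2).
  by apply: sin_ge0_pi; have := @pi_ge2 R => ?; apply/andP; split; lra.
have s1 : sin (x / 2) <= x / 2 by apply: sin_le_id; lra.
have : sin (x / 2) ^+ 2 <= (x / 2) ^+ 2 by rewrite lerXn2r // nnegrE //; lra.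
by set y := sin _ ^+ 2; lra.
Qed.

Lemma cos_doubling (x l : R) : 0 <= l -> l <= cos x -> 2 * l ^+ 2 - 1 <= cos (x *+ 2).
Proof.
move=> l0 lc; rewrite cos_mulr2n.
have : l ^+ 2 <= cos x ^+ 2 by rewrite lerXn2r // nnegrE (le_trans l0).
lra.
Qed.

(** If [pi < 3.14], then 1.57 exceeds [pi / 2] and [cos 1.57 <= 0]. Yet the quadratic lower bound at
    1.57 / 32, followed by five angle doublings, shows this cosine to be positive. *)
Lemma pi_lower_bound : 314 / 100 <= pi :> R.
Proof.
rewrite leNgt; apply/negP => pi_lt.
pose q : R := 157 / 100.
have : 0 < cos q.
  pose x := q / 32.
  have h0 : 1 - x ^+ 2 / 2 <= cos x.
    by apply: cos_ge_quadratic; rewrite /x /q; apply/andP; split; lra.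
  (* The bounds [h1] to [h5] are rounded down to eight decimals and written in nested base-100 form;
     this one is 0.99879643. *)
  have h1 : (99 + (87 + (96 + 43 / 100) / 100) / 100) / 100 <= cos x.
    by apply: le_trans h0; rewrite /x /q; lra.
  have h2 : (99 + (51 + (88 + 61 / 100) / 100) / 100) / 100 <= cos (x *+ 2).
    by apply: (le_trans _ (cos_doubling _ h1)); lra.
  have h3 : (98 + (8 + (0 + 73 / 100) / 100) / 100) / 100 <= cos (x *+ 4).
    rewrite (_ : x *+ 4 = (x *+ 2) *+ 2); last by rewrite -?mulrnA.
    by apply: (le_trans _ (cos_doubling _ h2)); lra.
  have h4 : (92 + (39 + (40 + 14 / 100) / 100) / 100) / 100 <= cos (x *+ 8).
    rewrite (_ : x *+ 8 = (x *+ 4) *+ 2); last by rewrite -?mulrnA.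
    by apply: (le_trans _ (cos_doubling _ h3)); lra.
  have h5 : (70 + (73 + (30 + 76 / 100) / 100) / 100) / 100 <= cos (x *+ 16).
    rewrite (_ : x *+ 16 = (x *+ 8) *+ 2); last by rewrite -?mulrnA.
    by apply: (le_trans _ (cos_doubling _ h4)); lra.
  have -> : q = x *+ 16 *+ 2 by rewrite /x; field.
  by apply: (lt_le_trans _ (cos_doubling _ h5)); lra.
have pq : pi / 2 < q by rewrite /q; lra.
have p2 := @pi_ge2 R.
have := @ltr_cos R (pi / 2) q.
rewrite cos_pihalf !in_itv /= => E; rewrite ltNge => /negP; apply.
rewrite ltW // E //.
- by apply/andP; split; lra.
- by rewrite /q; apply/andP; split; lra.
Qed.

End numerics.

(** * A numerical lower bound for the Gaussian tail *)

Section gaussian_tail.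
Context {R : realType}.
Local Notation leb := (@lebesgue_measure R).

(** [(1 - u + u^2 / 2) (1 + u + u^2 / 2) = 1 + u^4 / 4 >= 1], so the lower bound for [exp u] can be
    inverted. *)
Lemma expRN_le_quadratic (u : R) : 0 <= u -> expR (- u) <= 1 - u + u ^+ 2 / 2.
Proof.
move=> u0; rewrite expRN -div1r ler_pdivrMr ?expR_gt0 //.
have p0 : 0 <= 1 - u + u ^+ 2 / 2.
  have : 0 <= (u - 1) ^+ 2 by exact: sqr_ge0.
  by have : 0 <= u ^+ 2 by [exact: sqr_ge0]; lra.
apply: le_trans (ler_wpM2l p0 (expR_ge_quadratic u0)).
have : 0 <= u ^+ 4 by rewrite exprn_ge0.
lra.
Qed.

Lemma normal_pdf01E (x : R) :
  normal_pdf 0 1 x = normal_peak 1 * expR (- (x ^+ 2 / 2)).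
Proof.
rewrite normal_pdfE ?oner_eq0 //; congr (_ * expR _).
by rewrite subr0 expr1n mulNr.
Qed.

(** The integrand is the quadratic upper bound for [exp (- u)] at [u = x^2 / 2]. *)
Lemma integral_taylor (a : R) : 0 < a ->
  (\int[leb]_(x in `[(- a)%R, a]) (1 - x ^+ 2 / 2 + x ^+ 4 / 8)%:E =
   (2 * (a - a ^+ 3 / 6 + a ^+ 5 / 40))%:E)%E.
Proof.
move=> a0.
pose F (x : R) := x - x ^+ 3 / 6 + x ^+ 5 / 40.
have dF (x : R) : is_derive x 1 F (1 - x ^+ 2 / 2 + x ^+ 4 / 8).
  by apply: is_derive_eq; rewrite /GRing.scale /=; field.
have cF : continuous F.
  by move=> x; apply: differentiable_continuous; apply/derivable1_diffP.
rewrite (@continuous_FTC2 _ _ F).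
- by rewrite -EFinB /F; congr (_%:E); field.
- by lra.
- apply: continuous_subspaceT => x; apply: differentiable_continuous.
  exact/derivable1_diffP.
- split => //.
  + exact/cvg_at_right_filter/cF.
  + exact/cvg_at_left_filter/cF.
- by move=> x _; rewrite derive1E; exact: derive_val.
Qed.

Lemma normal_peak1_bound : 314 / 100 * 2 * normal_peak 1 ^+ 2 <= 1 :> R.
Proof.
have p0 := @pi_gt0 R; have p1 := @pi_lower_bound R.
have pp : 0 < pi *+ 2 :> R by rewrite mulrn_wgt0.
rewrite /normal_peak expr1n mul1r exprVn sqr_sqrtr ?(ltW pp) //.
rewrite ler_pdivrMr //; lra.
Qed.

(* 3/4 maximizes [a * P(|g| >= a)] up to the precision needed for the constant
   2.35. *)
Lemma normal_tail :
  ((2 * normal_peak 1)%:E <=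
   (235 / 100 * (3 / 4))%:E * normal_prob 0 1 [set x : R | 3 / 4 <= `|x|]%R)%E.
Proof.
pose a : R := 3 / 4; have a0 : 0 < a by rewrite /a; lra.
pose gam : probability (measurableTypeR R) R := normal_prob 0 1.
pose J : set R := `[- a, a]%classic.
pose A := [set x : R | 3 / 4 <= `|x|].
have mJ : measurable J by exact: measurable_itv.
have mA : measurable A.
  rewrite (_ : A = (@Num.norm R R) @^-1` `[3 / 4, +oo[).
    by rewrite -[X in measurable X]setTI; exact: (@normr_measurable R setT).
  by apply/seteqP; split=> x; rewrite /A /= in_itv /= andbT.
pose T : R := 2 * (a - a ^+ 3 / 6 + a ^+ 5 / 40).
have gJ : (gam J <= (normal_peak 1 * T)%:E)%E.
  have mpoly : measurable_fun setT (fun x : R => (1 - x ^+ 2 / 2 + x ^+ 4 / 8)%:E).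
    apply/measurable_EFinP; apply: measurable_funD.
      by apply: measurable_funB => //; apply: measurable_funM => //; exact: measurable_funX.
    by apply: measurable_funM => //; exact: measurable_funX.
  have poly0 (x : R) : 0 <= 1 - x ^+ 2 / 2 + x ^+ 4 / 8.
    have : 0 <= (x ^+ 2 / 2 - 1) ^+ 2 by exact: sqr_ge0.
    by have : 0 <= x ^+ 4 by [rewrite exprn_even_ge0]; lra.
  rewrite EFinM -(integral_taylor a0) -ge0_integralZl //; last 3 first.
  - exact: measurable_funTS.
  - by move=> x _; rewrite lee_fin.
  - by rewrite lee_fin normal_peak_ge0.
  apply: ge0_le_integral => //.
  - by move=> x _; rewrite lee_fin normal_pdf_ge0.
  - by apply/measurable_EFinP/measurable_funTS; exact: measurable_normal_pdf.
  - by apply: emeasurable_funM => //; exact: measurable_funTS.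
  move=> x _; rewrite -EFinM lee_fin normal_pdf01E ler_wpM2l ?normal_peak_ge0 //.
  have x2 : 0 <= x ^+ 2 / 2 by rewrite mulr_ge0 ?sqr_ge0.
  by apply: le_trans (expRN_le_quadratic x2) _; lra.
have gAJ : (1 <= gam A + gam J)%E.
  rewrite -(probability_setT gam).
  apply: (@le_trans _ _ (gam (A `|` J))); last first.
    by apply: measureU2; [exact: mA|exact: mJ].
  apply: le_measure; rewrite ?inE; first exact: measurableT.
    by apply: measurableU; [exact: mA|exact: mJ].
  move=> x _; rewrite /A /J /= in_itv /= -ler_norml.
  by case: (leP (3 / 4) `|x|) => h; [left|right; exact: ltW].
have fA : gam A \is a fin_num by apply: fin_num_measure; exact: mA.
rewrite -/A -[normal_prob _ _ A]/(gam A) -(fineK fA) -EFinM lee_fin.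
have : 1 <= fine (gam A) + normal_peak 1 * T.
  rewrite -lee_fin EFinD fineK //; apply: le_trans gAJ _.
  by rewrite leeD2l.
set g := fine _; set p := normal_peak 1.
have p0 : 0 <= p by exact: normal_peak_ge0.
have p2 : 314 / 100 * 2 * p ^+ 2 <= 1 by exact: normal_peak1_bound.
pose c : R := 235 / 100 * (3 / 4).
have c0 : 0 <= c by rewrite /c; lra.
(* As [g >= 1 - p T], the claim [2 p <= c g] follows from [p (2 + c T) <= c]. Squaring and
   [p^2 <= 1 / 6.28] leave an inequality between rationals. *)
suff : p * (2 + c * T) <= c by rewrite -/c => h1 /(ler_wpM2l c0); lra.
have T0 : 0 <= T by rewrite /T /a; lra.
have cT0 : 0 <= 2 + c * T by rewrite addr_ge0 // mulr_ge0.
rewrite -(@ler_pXn2r _ 2%N) ?nnegrE ?mulr_ge0 // exprMn.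
apply: (@le_trans _ _ ((314 / 100 * 2)^-1 * (2 + c * T) ^+ 2)).
  by rewrite ler_wpM2r ?sqr_ge0 // -[leRHS]mul1r ler_pdivlMr; lra.
rewrite /c /T /a; lra.
Qed.

End gaussian_tail.

(** * Euclidean and spectral norms, pseudo-inverses *)

Section euclidean_norm.
Context {R : realType}.
Implicit Types m n : nat.

Definition dotp n (u v : 'cV[R]_n) : R := \sum_i u i 0 * v i 0.

Lemma dotpE n (u v : 'cV[R]_n) : dotp u v = (u^T *m v) 0 0.
Proof. by rewrite mxE; apply: eq_bigr => i _; rewrite mxE. Qed.

Lemma dotp_mulmx m n (A : 'M[R]_(m, n)) u v : dotp u (A *m v) = dotp (A^T *m u) v.
Proof. by rewrite !dotpE trmx_mul trmxK mulmxA. Qed.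

Lemma dotpC n (u v : 'cV[R]_n) : dotp u v = dotp v u.
Proof. by apply: eq_bigr => i _; rewrite mulrC. Qed.

Lemma l2norm_ge0 n (v : 'cV[R]_n) : 0 <= l2norm v.
Proof. exact: sqrtr_ge0. Qed.

Lemma sqr_l2norm n (v : 'cV[R]_n) : l2norm v ^+ 2 = \sum_i v i 0 ^+ 2.
Proof. by rewrite sqr_sqrtr // sumr_ge0 // => i _; exact: sqr_ge0. Qed.

Lemma dotpp n (v : 'cV[R]_n) : dotp v v = l2norm v ^+ 2.
Proof. by rewrite sqr_l2norm; apply: eq_bigr => i _; rewrite expr2. Qed.

Lemma l2norm_eq0 n (v : 'cV[R]_n) : (l2norm v == 0) = (v == 0).
Proof.
apply/idP/eqP => [|->]; last first.
  by rewrite -sqrf_eq0 sqr_l2norm big1 // => i _; rewrite mxE expr0n.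
rewrite -sqrf_eq0 sqr_l2norm psumr_eq0; last by move=> i _; exact: sqr_ge0.
move=> /allP v0; apply/colP => i; rewrite mxE; apply/eqP.
by have := v0 i; rewrite mem_index_enum /= sqrf_eq0; apply.
Qed.

Lemma l2norm0 n : l2norm (0 : 'cV[R]_n) = 0.
Proof. by apply/eqP; rewrite l2norm_eq0. Qed.

Lemma l2norm_gt0 n (v : 'cV[R]_n) : (0 < l2norm v) = (v != 0).
Proof. by rewrite lt0r l2norm_eq0 l2norm_ge0 andbT. Qed.

Lemma l2normZ n (c : R) (v : 'cV[R]_n) : l2norm (c *: v) = `|c| * l2norm v.
Proof.
apply/eqP; rewrite -(@eqrXn2 _ 2) ?l2norm_ge0 ?mulr_ge0 ?l2norm_ge0 //.
rewrite exprMn !sqr_l2norm real_normK ?num_real // mulr_sumr.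
by apply/eqP/eq_bigr => i _; rewrite mxE exprMn.
Qed.

(** Nonnegativity of [|b u - d v|^2 = b (a b - d^2)] with [a = |u|^2], [b = |v|^2] and
    [d = <u, v>]. *)
Lemma cauchy_schwarz n (u v : 'cV[R]_n) : `|dotp u v| <= l2norm u * l2norm v.
Proof.
rewrite -(@ler_pXn2r _ 2) ?nnegrE ?mulr_ge0 ?l2norm_ge0 //.
rewrite real_normK ?num_real // exprMn.
have expand (b d : R) : \sum_i (b * u i 0 - d * v i 0) ^+ 2 =
    b ^+ 2 * (\sum_i u i 0 ^+ 2) - 2 * b * d * dotp u v +
    d ^+ 2 * \sum_i v i 0 ^+ 2.
  rewrite /dotp !mulr_sumr -sumrB -big_split /=.
  by apply: eq_bigr => i _; ring.
set a := l2norm u ^+ 2; set b := l2norm v ^+ 2; set d := dotp u v.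
have [v0|v0] := eqVneq v 0.
  rewrite /d /dotp big1 => [|i _]; last by rewrite v0 mxE mulr0.
  by rewrite expr0n /= mulr_ge0 // sqr_ge0.
have b0 : 0 < b by rewrite exprn_gt0 // l2norm_gt0.
have : 0 <= \sum_i (b * u i 0 - d * v i 0) ^+ 2.
  by apply: sumr_ge0 => i _; exact: sqr_ge0.
have -> : \sum_i (b * u i 0 - d * v i 0) ^+ 2 = b * (a * b - d ^+ 2).
  by rewrite expand -!sqr_l2norm -/a -/b -/d; ring.
by rewrite pmulr_rge0 // subr_ge0.
Qed.

Lemma ler_l2normD n (u v : 'cV[R]_n) : l2norm (u + v) <= l2norm u + l2norm v.
Proof.
rewrite -(@ler_pXn2r _ 2) ?nnegrE ?addr_ge0 ?l2norm_ge0 //.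
have -> : l2norm (u + v) ^+ 2 = l2norm u ^+ 2 + 2 * dotp u v + l2norm v ^+ 2.
  rewrite !sqr_l2norm /dotp mulr_sumr -!big_split /=.
  by apply: eq_bigr => i _; rewrite mxE; ring.
have := le_trans (ler_norm _) (cauchy_schwarz u v).
by rewrite sqrrD; lra.
Qed.

Lemma ler_l2norm_sum n (v : 'cV[R]_n) : l2norm v <= \sum_i `|v i 0|.
Proof.
rewrite -(@ler_pXn2r _ 2) ?nnegrE ?sumr_ge0 ?l2norm_ge0 // sqr_l2norm.
rewrite expr2 mulr_suml; apply: ler_sum => i _.
rewrite -real_normK ?num_real // expr2 ler_wpM2l //.
by rewrite (bigD1 i) //= lerDl sumr_ge0.
Qed.

Lemma ler_l2norm_mul m n (A : 'M[R]_(m, n)) v :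
  l2norm (A *m v) <= spectral_norm A * l2norm v.
Proof.
have [v0|v0] := eqVneq v 0; first by rewrite v0 mulmx0 !l2norm0 mulr0.
have n0 : (0 < n)%N.
  by case: n A v v0 => // A v; rewrite flatmx0 eqxx.
have [_ ub] := l2norm_mulmx_has_sup A n0.
have nv : 0 < l2norm v by rewrite l2norm_gt0.
rewrite -ler_pdivrMr //.
apply: (sup_upper_bound (l2norm_mulmx_has_sup A n0)).
exists ((l2norm v)^-1 *: v).
  by rewrite /= l2normZ gtr0_norm ?invr_gt0 // mulVf // gt_eqF.
by rewrite -scalemxAr l2normZ gtr0_norm ?invr_gt0 // mulrC.
Qed.

Lemma spectral_norm_ge0 m n (A : 'M[R]_(m, n)) : 0 <= spectral_norm A.
Proof.
case: n A => [|n] A.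
  rewrite /spectral_norm (_ : [set _ | _ in _] = set0) ?sup0 //.
  apply/seteqP; split=> // _ [v /= v1 _].
  by have := l2norm0 0; rewrite -(flatmx0 v) v1 => /eqP; rewrite oner_eq0.
have := le_trans (l2norm_ge0 _) (ler_l2norm_mul A (delta_mx 0 0)).
have d0 : 0 < l2norm (delta_mx 0 0 : 'cV[R]_n.+1).
  rewrite l2norm_gt0; apply/eqP => /colP /(_ 0) /eqP.
  by rewrite !mxE eqxx oner_eq0.
by rewrite pmulr_lge0.
Qed.

Lemma spectral_norm_le m n (A : 'M[R]_(m, n)) c : 0 <= c ->
  (forall v, l2norm (A *m v) <= c * l2norm v) -> spectral_norm A <= c.
Proof.
move=> c0 H; case: n A H => [|n] A H.
  rewrite /spectral_norm (_ : [set _ | _ in _] = set0) ?sup0 //.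
  apply/seteqP; split=> // _ [v /= v1 _].
  by have := l2norm0 0; rewrite -(flatmx0 v) v1 => /eqP; rewrite oner_eq0.
apply: ge_sup; first by have [] := @l2norm_mulmx_has_sup R _ _ A isT.
by move=> _ [v /= v1 <-]; rewrite (le_trans (H v)) // v1 mulr1.
Qed.

Lemma spectral_norm_gt m n (A : 'M[R]_(m, n)) c : 0 <= c ->
  c < spectral_norm A -> exists2 v, l2norm v = 1 & c < l2norm (A *m v).
Proof.
move=> c0 cA; apply: contrapT => H.
have : spectral_norm A <= c; last by rewrite leNgt cA.
apply: spectral_norm_le => // v.
have [v0|v0] := eqVneq v 0; first by rewrite v0 mulmx0 !l2norm0 mulr0.
have nv : 0 < l2norm v by rewrite l2norm_gt0.
rewrite leNgt; apply/negP => lt; apply: H; exists ((l2norm v)^-1 *: v).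
  by rewrite l2normZ gtr0_norm ?invr_gt0 // mulVf // gt_eqF.
by rewrite -scalemxAr l2normZ gtr0_norm ?invr_gt0 // mulrC ltr_pdivlMr.
Qed.

Lemma spectral_norm_eq0 m n (A : 'M[R]_(m, n)) : (spectral_norm A == 0) = (A == 0).
Proof.
apply/eqP/eqP => [A0|->]; last first.
  apply/eqP; rewrite eq_le spectral_norm_ge0 andbT.
  by apply: spectral_norm_le => // v; rewrite mul0mx l2norm0 mul0r.
apply/matrixP => i j.
have /eqP : l2norm (A *m delta_mx j 0) == 0.
  rewrite eq_le l2norm_ge0 andbT.
  by apply: le_trans (ler_l2norm_mul _ _) _; rewrite A0 mul0r.
by move/eqP; rewrite l2norm_eq0 -colE => /eqP/colP/(_ i); rewrite !mxE.
Qed.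

(** [|A^T v|^2 = <v, A A^T v> <= |v| |A| |A^T v|], and one factor cancels. *)
Lemma spectral_norm_tr_le m n (A : 'M[R]_(m, n)) :
  spectral_norm A^T <= spectral_norm A.
Proof.
apply: spectral_norm_le => [|v]; first exact: spectral_norm_ge0.
have [->|nz] := eqVneq (l2norm (A^T *m v)) 0.
  by rewrite mulr_ge0 ?spectral_norm_ge0 ?l2norm_ge0.
have nz0 : 0 < l2norm (A^T *m v) by rewrite lt0r nz l2norm_ge0.
rewrite -(ler_pM2r nz0) -expr2 -dotpp -dotp_mulmx.
apply: le_trans (ler_norm _) (le_trans (cauchy_schwarz _ _) _).
rewrite mulrAC mulrC ler_wpM2r ?l2norm_ge0 //.
exact: ler_l2norm_mul.
Qed.

Lemma spectral_norm_tr m n (A : 'M[R]_(m, n)) : spectral_norm A^T = spectral_norm A.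
Proof.
apply/eqP; rewrite eq_le spectral_norm_tr_le /=.
by rewrite -{1}(trmxK A) spectral_norm_tr_le.
Qed.

Lemma mpinv_tr m n (A : 'M[R]_(m, n)) : mpinv A^T = (mpinv A)^T.
Proof.
apply/esym/mpinv_unique; have [h1 h2 h3 h4] := mpinvP A.
by split; rewrite -!trmx_mul ?mulmxA ?h1 ?h2 // ?h3 ?h4 ?trmxK.
Qed.

(** [A^+ A] is the orthogonal projection onto the range of [A^T]. *)
Lemma mulmx_mpinv_tr m n (A : 'M[R]_(m, n)) : mpinv A *m (A *m A^T) = A^T.
Proof.
have [h1 _ _ h4] := mpinvP A.
by rewrite -[in RHS]h1 -mulmxA trmx_mul h4 mulmxA.
Qed.

(** [A^+] takes its values in the range of [A^T] and inverts [A] there, and [A A^+] is an orthogonal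
    projection. The criterion replaces the pseudo-inverse by explicit inequalities in [A]. *)
Lemma spectral_norm_mpinv_le m n (A : 'M[R]_(m, n)) t : 0 <= t ->
  (spectral_norm (mpinv A) <= t) <->
  (forall w, l2norm (A^T *m w) <= t * l2norm (A *m (A^T *m w))).
Proof.
move=> t0; split=> [le_t w|H].
  rewrite -{1}mulmx_mpinv_tr -!mulmxA.
  apply: le_trans (ler_l2norm_mul _ _) _.
  by rewrite ler_wpM2r // l2norm_ge0.
have [h1 h2 h3 h4] := mpinvP A; set X := mpinv A in h1 h2 h3 h4 *.
apply: spectral_norm_le => // z.
have XE : X *m z = A^T *m (X^T *m (X *m z)) by rewrite !mulmxA -trmx_mul h4 h2.
have := H (X^T *m (X *m z)); rewrite -XE.
move/le_trans; apply; rewrite ler_wpM2l // mulmxA.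
(* [Q] is symmetric and idempotent, so [|Q z|^2 = <z, Q z>] and hence [|Q z| <= |z|]. *)
set Q := A *m X in h3 *.
have QQ : Q^T *m Q = Q by rewrite h3 /Q mulmxA h1.
have [->|nz] := eqVneq (l2norm (Q *m z)) 0; first exact: l2norm_ge0.
have nz0 : 0 < l2norm (Q *m z) by rewrite lt0r nz l2norm_ge0.
rewrite -(ler_pM2r nz0) -expr2 -dotpp dotp_mulmx mulmxA QQ dotpC.
exact: le_trans (ler_norm _) (cauchy_schwarz _ _).
Qed.

End euclidean_norm.

(** * Reduction of [G M] to an invertible square matrix *)

Section reduction.
Context {R : realType}.

(* On the range of [(G *m M)^T] the minimal-norm solution [x] of [P x = P L c]
   is dominated by [L c], which lies in the row space of [M]. *)
Lemma spectral_norm_mpinv_mulmx (m n r k : nat) (G : 'M[R]_(r, m))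
    (M : 'M[R]_(m, n)) (L : 'M[R]_(n, k)) (S : 'M[R]_(k, r)) (N : 'M[R]_(m, k)) :
  L = M^T *m N -> (forall y, l2norm (S *m y) <= l2norm y) ->
  (forall u : 'cV_m, exists c : 'cV_k, M^T *m u = L *m c) \/
    (forall y y' : 'cV_r, S *m y = S *m y' -> y = y') ->
  S *m G *m (M *m L) \in unitmx ->
  spectral_norm (mpinv (G *m M)) <= spectral_norm (mpinv M) *
    spectral_norm (M *m L *m invmx (S *m G *m (M *m L))).
Proof.
move=> LE Sle hcase; set B := S *m G *m _ => uB.
set W := M *m L *m _; set P := G *m M.
apply/spectral_norm_mpinv_le => [|w]; first by rewrite mulr_ge0 ?spectral_norm_ge0.
set x := P^T *m w.
have BE z : S *m (P *m (L *m z)) = B *m z by rewrite /B /P !mulmxA.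
(* Either [x = M^T (G^T w)] is itself in the range of [L], or [S] is injective and it suffices to
   solve [B c = S P x]. *)
have [c cE] : exists c, P *m (L *m c) = P *m x.
  case: hcase => [/(_ (G^T *m w)) [c Lc]|Sinj].
    by exists c; rewrite -Lc /x /P trmx_mul !mulmxA.
  exists (invmx B *m (S *m (P *m x))); apply: Sinj.
  by rewrite BE mulKVmx.
have xL : l2norm x <= l2norm (L *m c).
  have [->|nz] := eqVneq (l2norm x) 0; first exact: l2norm_ge0.
  have nz0 : 0 < l2norm x by rewrite lt0r nz l2norm_ge0.
  rewrite -(ler_pM2l nz0) -expr2 -dotpp.
  (* Since [x = P^T w], the product [<x, v>] depends on [v] only through [P v]. *)
  have -> : dotp x x = dotp x (L *m c).
    have xE (v : 'cV_n) : dotp x v = dotp w (P *m v) by rewrite dotp_mulmx.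
    by rewrite !xE cE.
  exact: le_trans (ler_norm _) (cauchy_schwarz _ _).
apply: le_trans xL _.
(* [L c = M^T (N c)] lies in the range of [M^T], where the criterion for [M] gives
   [|L c| <= |M^+| |M L c|]; moreover [M L c = W S P x]. *)
have /(spectral_norm_mpinv_le _ (spectral_norm_ge0 _)) /(_ (N *m c)) :=
  lexx (spectral_norm (mpinv M)).
rewrite mulmxA -LE => /le_trans; apply; rewrite -mulrA.
rewrite ler_wpM2l ?spectral_norm_ge0 //.
have -> : M *m (L *m c) = W *m (S *m (P *m (L *m c))).
  by rewrite BE /W -mulmxA mulKmx // mulmxA.
apply: le_trans (ler_l2norm_mul _ _) _.
by rewrite cE ler_wpM2l ?spectral_norm_ge0.
Qed.

Lemma mul_pid_mx_l (k r m : nat) (le_kr : (k <= r)%N) (G : 'M[R]_(r, m)) i j :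
  (pid_mx k *m G : 'M[R]_(k, m)) i j = G (widen_ord le_kr i) j.
Proof.
rewrite mxE (bigD1 (widen_ord le_kr i)) //= big1 => [|l nl].
  by rewrite mxE /= eqxx ltn_ord mul1r addr0.
rewrite mxE; case: eqP => [il|]; last by rewrite mul0r.
by case/eqP: nl; apply: val_inj.
Qed.

Lemma l2norm_pid_mx (k r : nat) (y : 'cV[R]_r) : (k <= r)%N ->
  l2norm (pid_mx k *m y : 'cV_k) <= l2norm y.
Proof.
move=> le_kr; rewrite -(@ler_pXn2r _ 2) ?nnegrE ?l2norm_ge0 // !sqr_l2norm.
have -> : \sum_i (pid_mx k *m y : 'cV_k) i 0 ^+ 2 =
    \sum_(i < r | (i < k)%N) y i 0 ^+ 2.
  rewrite (big_ord_narrow le_kr); apply: eq_bigr => i _.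
  by rewrite (mul_pid_mx_l le_kr).
by rewrite big_mkcond; apply: ler_sum => i _; case: ifP => // _; exact: sqr_ge0.
Qed.

(** The columns of [L] are the first [k] vectors of a basis of the row space of [M]. If
    [rank M <= r] they span it; otherwise [k = r] and [pid_mx k] is the identity. As the row space
    meets the kernel of [M] only in 0, [M L] is injective. *)
Lemma row_space_compression (m n r : nat) (M : 'M[R]_(m, n)) :
  let k := minn r (\rank M) in
  exists (L : 'M[R]_(n, k)) (N : 'M[R]_(m, k)),
  [/\ L = M^T *m N,
      (forall u : 'cV_m, exists c : 'cV_k, M^T *m u = L *m c) \/
        (forall y y' : 'cV_r, (pid_mx k : 'M[R]_(k, r)) *m y = pid_mx k *m y' -> y = y')
    & forall c : 'cV_k, M *m L *m c = 0 -> c = 0].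
Proof.
move=> k; have k_r : (k <= r)%N by exact: geq_minl.
have k_rho : (k <= \rank M)%N by exact: geq_minr.
pose L : 'M[R]_(n, k) := (row_base M)^T *m pid_mx k.
have [X RX] : exists X, row_base M = X *m M.
  by apply/submxP; rewrite eq_row_base.
have [Y MY] : exists Y, M = Y *m row_base M.
  by apply/submxP; rewrite eq_row_base.
have pidK : (pid_mx k : 'M[R]_(k, \rank M)) *m (pid_mx k : 'M[R]_(\rank M, k)) = 1%:M.
  by rewrite mul_pid_mx minnn (minn_idPr k_rho) pid_mx_1.
have LE : L = M^T *m (X^T *m pid_mx k) by rewrite /L {1}RX trmx_mul mulmxA.
exists L, (X^T *m pid_mx k); split=> //.
- have [rho_r|r_rho] := leqP (\rank M) r; [left|right].
    have kE : k = \rank M by apply/minn_idPr.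
    move=> u; exists (pid_mx k *m (Y^T *m u)).
    rewrite /L -!mulmxA [pid_mx k *m (pid_mx k *m _)]mulmxA mul_pid_mx.
    by rewrite {1}MY trmx_mul !kE !minnn pid_mx_1 mul1mx mulmxA.
  have kE : k = r by apply/minn_idPl/ltnW.
  move=> y y' /(congr1 (mulmx (pid_mx k : 'M[R]_(r, k)))).
  by rewrite !mulmxA !mul_pid_mx !kE !minnn !pid_mx_1 !mul1mx.
- move=> c McE.
  have LcE : L *m c = M^T *m (X^T *m pid_mx k *m c) by rewrite mulmxA -LE.
  have : L *m c = 0.
    apply/eqP; rewrite -l2norm_eq0 -sqrf_eq0 -dotpp {1}LcE -dotp_mulmx.
    by rewrite mulmxA McE /dotp big1 // => i _; rewrite !mxE mulr0.
  move=> /(congr1 trmx); rewrite /L trmx_mul trmx_mul trmxK trmx0 mulmxA => c0.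
  have : c^T *m (pid_mx k : 'M[R]_(\rank M, k))^T = 0.
    by apply: (row_free_inj (row_base_free M)); rewrite c0 mul0mx.
  move=> /(congr1 (mulmx^~ (pid_mx k : 'M[R]_(\rank M, k)))).
  rewrite mul0mx tr_pid_mx -mulmxA pidK mulmx1 => /(congr1 trmx).
  by rewrite trmxK trmx0.
Qed.

End reduction.

(** * Gaussian matrices *)

Section gaussian_linear_forms.
Context {R : realType}.

Definition std_normal : probability (measurableTypeR R) R := normal_prob 0 1.
Local Notation gam := std_normal.

Lemma std_normal_rotation : rotation_invariant gam.
Proof. by move=> c s A B; exact: normal_prob_rotation. Qed.

Lemma iid_coord (I : finType) d (T : measurableType d) (P : probability T R)
    (X : T -> I -> R) i (A : set R) :
  iid_fam gam P X -> measurable A -> P [set w | A (X w i)] = gam A.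
Proof.
move=> [mX X_] mA.
have -> : [set w | A (X w i)] =
    [set w | forall j, (if j == i then A else setT) (X w j)].
  apply/seteqP; split=> w /= H; last by have := H i; rewrite eqxx.
  by move=> j; case: eqP => [->|].
rewrite (X_ (fun j => if j == i then A else setT)); last by move=> j; case: eqP.
rewrite (bigD1 i) //= eqxx big1 ?mule1 // => j /negbTE ->.
exact: (probability_setT gam).
Qed.

(* A plane rotation merges two coefficients of the form into one. *)
Lemma iid_linear_form (I : finType) d (T : measurableType d)
    (P : probability T R) (X : T -> I -> R) (b : I -> R) :
  iid_fam gam P X -> (exists p, b p != 0) ->
  exists beta : R, beta ^+ 2 = \sum_i b i ^+ 2 /\
    forall A, measurable A ->
      P [set w | A (\sum_i b i * X w i)] = gam [set x | A (beta * x)].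
Proof.
(* Induction on the number of nonzero coefficients. *)
have [N] := ubnP #|[pred i | b i != 0]|.
elim: N b X => // N IH b X; rewrite ltnS => leN iX [p bp].
have [[q /andP[qp bq]]|Hq] := pselect (exists q, (q != p) && (b q != 0)); last first.
  have b0 i : i != p -> b i = 0.
    by move=> ip; apply/eqP/negP => /negP bi; apply: Hq; exists i; rewrite ip.
  exists (b p); split=> [|A mA].
    by rewrite (bigD1 p) //= big1 ?addr0 // => i ip; rewrite b0 // expr0n.
  have mB : measurable [set x : R | A (b p * x)].
    rewrite -[X in measurable X]setTI.
    exact: (mulrl_measurable (b p) measurableT mA).
  rewrite -(iid_coord p iX mB); congr (P _).
  apply/seteqP; split=> w /=; rewrite (bigD1 p) //= big1 ?addr0 //;
    by move=> i ip; rewrite b0 // mul0r.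
(* The rotation with cosine [c = b p / h] and sine [s = b q / h] carries [(b p, b q)] to
   [(h, 0)]. *)
pose h := Num.sqrt (b p ^+ 2 + b q ^+ 2).
have h2 : h ^+ 2 = b p ^+ 2 + b q ^+ 2 by rewrite sqr_sqrtr // addr_ge0 ?sqr_ge0.
have h0 : h != 0.
  by rewrite -sqrf_eq0 h2 gt_eqF // ltr_wpDr ?sqr_ge0 // exprn_even_gt0.
pose c := b p / h; pose s := b q / h.
have s0 : s != 0 by rewrite mulf_neq0 // invr_eq0.
have cs1 : c ^+ 2 + s ^+ 2 = 1.
  by rewrite !expr_div_n -mulrDl -h2 divff // expf_neq0.
pose b' i := if i == p then h else if i == q then 0 else b i.
have pq : p != q by rewrite eq_sym.
have b'p : b' p = h by rewrite /b' eqxx.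
have b'q : b' q = 0 by rewrite /b' eqxx (negbTE qp).
have b'o i : i != p -> i != q -> b' i = b i.
  by rewrite /b' => /negbTE -> /negbTE ->.
have sumE (F : I -> R) : \sum_i F i =
    F p + F q + \sum_(i | (i != p) && (i != q)) F i.
  by rewrite (bigD1 p) //= (bigD1 q) //= addrA.
have iX' := iid_fam_rot2 std_normal_rotation pq s0 cs1 iX.
have [||beta [beta2 law]] := IH b' _ _ iX'.
- apply: leq_trans leN; apply: proper_card; apply/properP; split.
    apply/fintype.subsetP => i; rewrite !inE /b'; case: (eqVneq i p) => [->//|_].
    by case: (eqVneq i q) => //; rewrite eqxx.
  by exists q; rewrite !inE // b'q eqxx.
- by exists p; rewrite b'p.
exists beta; split=> [|A mA].
  rewrite beta2 !sumE b'p b'q h2 expr0n addr0; congr (_ + _).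
  by apply: eq_bigr => i /andP[ip iq]; rewrite b'o.
rewrite -law //; congr (P _).
suff E w : \sum_i b i * X w i = \sum_i b' i * rot2 p q c s (X w) i.
  by apply/seteqP; split=> w /=; rewrite E.
rewrite !sumE b'p b'q mul0r addr0 /rot2 eqxx; congr (_ + _).
  by rewrite /c /s; field.
by apply: eq_bigr => i /andP[ip iq]; rewrite b'o // (negbTE ip) (negbTE iq).
Qed.

(** The form has the law of [beta g] with [|beta|] the norm of [b]; the interval bound applies and
    [|beta|] cancels. *)
Lemma iid_linear_form_small (I : finType) d (T : measurableType d)
    (P : probability T R) (X : T -> I -> R) (b : I -> R) (u e : R) :
  iid_fam gam P X -> 0 < \sum_i b i ^+ 2 -> 0 <= e ->
  (P [set w | `|\sum_i b i * X w i + u| <= e * Num.sqrt (\sum_i b i ^+ 2)]%R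
   <= (2 * normal_peak 1 * e)%:E)%E.
Proof.
move=> iX b0 e0.
have [p bp] : exists p, b p != 0.
  apply: contrapT => H; move: b0; rewrite big1 ?ltxx // => i _.
  have [->|bi] := eqVneq (b i) 0; first by rewrite expr0n.
  by case: H; exists i.
have [beta [beta2 law]] := iid_linear_form iX (ex_intro _ p bp).
have bn : Num.sqrt (\sum_i b i ^+ 2) = `|beta| by rewrite -beta2 sqrtr_sqr.
have beta0 : beta != 0 by rewrite -sqrf_eq0 beta2 gt_eqF.
pose A := [set y : R | `|y + u| <= e * `|beta|].
have mA : measurable A.
  have mf : measurable_fun setT (fun y : R => `|y + u|).
    apply: (measurableT_comp (@normr_measurable R setT)).
    exact: measurable_funD.
  rewrite (_ : A = (fun y : R => `|y + u|) @^-1` `]-oo, e * `|beta|]).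
    by rewrite -[X in measurable X]setTI; exact: mf.
  by apply/seteqP; split=> y; rewrite /A /= in_itv.
rewrite bn [X in (X <= _)%E](law A mA).
apply: le_trans (normal_prob_interval u beta0 (mulr_ge0 e0 (normr_ge0 beta))) _.
by rewrite lee_fin mulrA mulfK // normr_eq0.
Qed.

(** Here [|beta| >= t], so [|g| >= e] forces [|beta g| >= e t]. *)
Lemma iid_linear_form_large (I : finType) d (T : measurableType d)
    (P : probability T R) (X : T -> I -> R) (b : I -> R) (e t : R) :
  iid_fam gam P X -> 0 <= e -> 0 < t -> t <= Num.sqrt (\sum_i b i ^+ 2) ->
  (gam [set x | e <= `|x|]%R <=
   P [set w | e * t <= `|\sum_i b i * X w i|]%R)%E.
Proof.
move=> iX e0 t0 tb.
have b0 : 0 < \sum_i b i ^+ 2 by rewrite -sqrtr_gt0; exact: lt_le_trans tb.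
have [p bp] : exists p, b p != 0.
  apply: contrapT => H; move: b0; rewrite big1 ?ltxx // => i _.
  have [->|bi] := eqVneq (b i) 0; first by rewrite expr0n.
  by case: H; exists i.
have [beta [beta2 law]] := iid_linear_form iX (ex_intro _ p bp).
have bn : Num.sqrt (\sum_i b i ^+ 2) = `|beta| by rewrite -beta2 sqrtr_sqr.
have mge (c : R) : measurable [set y : R | c <= `|y|].
  rewrite (_ : [set y : R | c <= `|y|] = (@Num.norm R R) @^-1` `[c, +oo[).
    by rewrite -[X in measurable X]setTI; exact: (@normr_measurable R setT).
  by apply/seteqP; split=> y; rewrite /= in_itv /= andbT.
rewrite [X in (_ <= X)%E](law _ (mge (e * t))).
have mB : measurable [set x : R | e * t <= `|beta * x|].
  by rewrite -[X in measurable X]setTI; exact: (mulrl_measurable beta measurableT (mge (e * t))).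
apply: le_measure; rewrite ?inE; [exact: mge|exact: mB|].
move=> x /= ex; rewrite normrM mulrC -bn.
by apply: ler_pM => //; exact: ltW.
Qed.

End gaussian_linear_forms.

(** * Measurability of matrix operations *)

Section random_matrices_measurability.
Context {R : realType} d (T : measurableType d).

Definition measurable_mx m n (Z : T -> 'M[R]_(m, n)) :=
  forall i j, measurable_fun setT (fun w => Z w i j).

Lemma measurable_mx_cst m n (A : 'M[R]_(m, n)) : measurable_mx (fun=> A).
Proof. by move=> i j; exact: measurable_cst. Qed.

Lemma measurable_mxD m n (Y Z : T -> 'M[R]_(m, n)) :
  measurable_mx Y -> measurable_mx Z -> measurable_mx (fun w => Y w + Z w).
Proof.
move=> mY mZ i j; under eq_fun do rewrite mxE.
exact: measurable_funD.
Qed.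

Lemma measurable_mulmx m n p (Y : T -> 'M[R]_(m, n)) (Z : T -> 'M[R]_(n, p)) :
  measurable_mx Y -> measurable_mx Z -> measurable_mx (fun w => Y w *m Z w).
Proof.
move=> mY mZ i j; under eq_fun do rewrite mxE.
by apply: measurable_sum => l; exact: measurable_funM.
Qed.

Lemma measurable_trmx m n (Z : T -> 'M[R]_(m, n)) :
  measurable_mx Z -> measurable_mx (fun w => (Z w)^T).
Proof. by move=> mZ i j; under eq_fun do rewrite mxE; exact: mZ. Qed.

Lemma measurable_det n (Z : T -> 'M[R]_n) :
  measurable_mx Z -> measurable_fun setT (fun w => \det (Z w)).
Proof.
move=> mZ; rewrite /determinant; apply: measurable_sum => s.
apply: measurable_funM => //.
by apply: measurable_prod => i _; exact: mZ.
Qed.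

Lemma measurable_adj n (Z : T -> 'M[R]_n) :
  measurable_mx Z -> measurable_mx (fun w => \adj (Z w)).
Proof.
move=> mZ i j; under eq_fun do rewrite mxE /cofactor.
apply: measurable_funM => //; apply: measurable_det => a b.
by under eq_fun do rewrite !mxE; exact: mZ.
Qed.

Lemma measurable_l2norm n (v : T -> 'cV[R]_n) :
  measurable_mx v -> measurable_fun setT (fun w => l2norm (v w)).
Proof.
move=> mv; rewrite /l2norm.
apply: (measurableT_comp (continuous_measurable_fun (@sqrt_continuous R))).
by apply: measurable_sum => i; exact: measurable_funX.
Qed.

Lemma measurable_le (f g : T -> R) :
  measurable_fun setT f -> measurable_fun setT g ->
  measurable [set w | f w <= g w].
Proof.
move=> mf mg; rewrite (_ : [set _ | _] = (fun w => g w - f w) @^-1` `[0, +oo[).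
  by rewrite -[X in measurable X]setTI; exact: measurable_funB.
by apply/seteqP; split=> w; rewrite /= in_itv /= andbT subr_ge0.
Qed.

Lemma measurable_eq0 (f : T -> R) :
  measurable_fun setT f -> measurable [set w | f w = 0].
Proof.
move=> mf; rewrite (_ : [set _ | _] = [set w | f w <= 0] `&` [set w | 0 <= f w]).
  by apply: measurableI; exact: measurable_le.
apply/seteqP; split=> w /= => [->|[f1 f2]]; first by split.
by apply/eqP; rewrite eq_le f1 f2.
Qed.

End random_matrices_measurability.

(** * Matrices with independent standard Gaussian entries *)

Section gaussian_matrices.
Context {R : realType}.
Local Notation gam := (@std_normal R).

Definition iid_mx d (T : measurableType d) (P : probability T R) m n
    (Z : T -> 'M[R]_(m, n)) :=
  iid_fam gam P (fun w (p : 'I_m * 'I_n) => Z w p.1 p.2).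

Lemma iid_mx_measurable d (T : measurableType d) (P : probability T R) m n
    (Z : T -> 'M[R]_(m, n)) : iid_mx P Z -> measurable_mx Z.
Proof. by move=> [mZ _] i j; exact: (mZ (i, j)). Qed.

(** Reassembles a family indexed by pairs, so that matrix events become subsets of the product space
    [mx_space]. *)
Definition mx_of_fam m n (f : 'I_m * 'I_n -> R) : 'M[R]_(m, n) :=
  \matrix_(i, j) f (i, j).

Definition mx_space m n := fam_space (R := R) ('I_m * 'I_n)%type.

Lemma measurable_mx_of_fam m n :
  measurable_mx (fun f : mx_space m n => mx_of_fam f).
Proof.
move=> i j.
have -> : (fun f : mx_space m n => mx_of_fam f i j) = (fun f => f (i, j)).
  by apply/funext => f; rewrite mxE.
exact: measurable_coord.
Qed.

Definition patch_row m n (i : 'I_m) (Y Z : 'M[R]_(m, n)) : 'M[R]_(m, n) :=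
  \matrix_(a, b) if a == i then Y a b else Z a b.

(** Row [i] is replaced by an independent copy, which turns the probability into an average, over
    the other rows, of a probability in row [i] alone. *)
Lemma iid_mx_decouple_row d (T : measurableType d) (P : probability T R) m n
    (Z : T -> 'M[R]_(m, n)) (i : 'I_m) (B : set 'M[R]_(m, n)) :
  iid_mx P Z -> measurable [set f : mx_space m n | B (mx_of_fam f)] ->
  P [set w | B (Z w)] =
  (\int[P]_w P [set w' | B (patch_row i (Z w') (Z w))])%E.
Proof.
move=> iZ mB.
have iY := iid_fam_decouple (fun p => p.1 != i) iZ iZ.
have ZE w : mx_of_fam (fun p => Z w p.1 p.2) = Z w.
  by apply/matrixP => a b; rewrite mxE.
transitivity (P ((fun w (p : 'I_m * 'I_n) => Z w p.1 p.2) @^-1`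
    [set f | B (mx_of_fam f)])).
  by congr (P _); apply/seteqP; split=> w /=; rewrite ZE.
apply: (etrans (iid_fam_law iZ iY mB)).
apply: eq_integral => w _; congr (P _).
apply/seteqP; split=> w' /=; rewrite /xsection /= inE /=.
- suff -> : mx_of_fam (fun p => if p.1 != i then Z w p.1 p.2 else Z w' p.1 p.2) =
    patch_row i (Z w') (Z w) by [].
  by apply/matrixP => a b; rewrite !mxE /=; case: (a == i).
- suff -> : mx_of_fam (fun p => if p.1 != i then Z w p.1 p.2 else Z w' p.1 p.2) =
    patch_row i (Z w') (Z w) by [].
  by apply/matrixP => a b; rewrite !mxE /=; case: (a == i).
Qed.

(** A bound for almost all values of the other rows suffices: the integrand is at most [C + \1_N],
    and [P N = 0]. *)
Lemma iid_mx_row_bound d (T : measurableType d) (P : probability T R) m n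
    (Z : T -> 'M[R]_(m, n)) (i : 'I_m) (B : set 'M[R]_(m, n)) (N : set T) C :
  iid_mx P Z -> measurable [set f : mx_space m n | B (mx_of_fam f)] ->
  measurable N -> P N = 0%E -> 0 <= C ->
  (forall w, ~ N w -> (P [set w' | B (patch_row i (Z w') (Z w))] <= C%:E)%E) ->
  (P [set w | B (Z w)] <= C%:E)%E.
Proof.
move=> iZ mB mN PN C0 H; rewrite (iid_mx_decouple_row i iZ mB).
have mZ := iid_mx_measurable iZ.
pose f (z : T * T) (p : 'I_m * 'I_n) :=
  if p.1 == i then Z z.2 p.1 p.2 else Z z.1 p.1 p.2.
have mf : measurable_fun setT (f : T * T -> mx_space m n).
  apply: measurable_fam => p; rewrite /f; case: (_ == _).
    exact: (measurableT_comp (mZ p.1 p.2)).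
  exact: (measurableT_comp (mZ p.1 p.2)).
have mS : measurable (f @^-1` [set f | B (mx_of_fam f)]).
  by rewrite -[X in measurable X]setTI; exact: mf.
have pE w w' : mx_of_fam (f (w, w')) = patch_row i (Z w') (Z w).
  by apply/matrixP => a b; rewrite !mxE.
have secE w : [set w' | B (patch_row i (Z w') (Z w))] =
    xsection (f @^-1` [set f | B (mx_of_fam f)]) w.
  by apply/seteqP; split=> w' /=; rewrite /xsection /= inE /= pE.
have msec w : measurable [set w' | B (patch_row i (Z w') (Z w))].
  by rewrite secE; exact: measurable_xsection.
have mPsec : measurable_fun setT
    (fun w => P [set w' | B (patch_row i (Z w') (Z w))]).
  have -> : (fun w => P [set w' | B (patch_row i (Z w') (Z w))]) =
      P \o xsection (f @^-1` [set f | B (mx_of_fam f)]).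
    by apply/funext => w; rewrite /= secE.
  exact: measurable_fun_xsection.
apply: (@le_trans _ _ (\int[P]_w (C%:E + (\1_N w)%:E))%E).
  apply: ge0_le_integral => //.
  - apply: emeasurable_funD => //; apply/measurable_EFinP.
    exact: measurable_indic.
  move=> w _; have [Nw|Nw] := pselect (N w); last first.
    by rewrite indicE memNset //= adde0; exact: H.
  rewrite indicE mem_set //=; apply: le_trans (probability_le1 P (msec w)) _.
  by rewrite -EFinD lee_fin lerDr.
rewrite ge0_integralD //; last first.
  by apply/measurable_EFinP; exact: measurable_indic.
rewrite integral_cst //= probability_setT mule1 integral_indic //= setIT.
by rewrite PN adde0.
Qed.

Lemma iid_mx_row d (T : measurableType d) (P : probability T R) m n
    (Z : T -> 'M[R]_(m, n)) i :
  iid_mx P Z -> iid_fam gam P (fun w j => Z w i j).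
Proof.
by apply: (iid_fam_comp (h := fun j => (i, j))) => j j' [].
Qed.

Lemma iid_mx_col d (T : measurableType d) (P : probability T R) m n
    (Z : T -> 'M[R]_(m, n)) j :
  iid_mx P Z -> iid_fam gam P (fun w i => Z w i j).
Proof.
by apply: (iid_fam_comp (h := fun i => (i, j))) => i i' [].
Qed.

Lemma iid_mx_rowsub d (T : measurableType d) (P : probability T R) m m' n
    (Z : T -> 'M[R]_(m, n)) (f : 'I_m' -> 'I_m) :
  injective f -> iid_mx P Z -> iid_mx P (fun w => \matrix_(i, j) Z w (f i) j).
Proof.
move=> fi iZ.
have := iid_fam_comp (h := fun p : 'I_m' * 'I_n => (f p.1, p.2)) _ iZ.
rewrite /iid_mx; under [in X in _ -> X]eq_fun do under eq_fun do rewrite mxE.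
by apply=> -[a b] [a' b'] [/fi -> ->].
Qed.

End gaussian_matrices.

(** * Cofactors and the determinant of a shifted Gaussian product *)

Section shifted_gaussian_determinant.
Context {R : realType} d (T : measurableType d) (P : probability T R).

Lemma row'_patch_row m n (i : 'I_m.+1) (Y Z : 'M[R]_(m.+1, n)) :
  row' i (patch_row i Y Z) = row' i Z.
Proof.
by apply/matrixP => a b; rewrite !mxE eq_sym (negbTE (neq_lift i a)).
Qed.

(** The cofactors along row [i] involve only the other rows. *)
Lemma col_adj_row' k m (i : 'I_k.+1) (Y Z : 'M[R]_(k.+1, m)) (K : 'M[R]_(m, k.+1)) :
  row' i Y = row' i Z -> col i (\adj (Y *m K)) = col i (\adj (Z *m K)).
Proof.
move=> YZ; apply/colP => j; rewrite !mxE /cofactor; congr (_ * \det _).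
have rE (W : 'M[R]_(k.+1, m)) : row' i (col' j (W *m K)) = row' i W *m col' j K.
  by apply/matrixP => a b; rewrite !mxE; apply: eq_bigr => l _; rewrite !mxE.
by rewrite !rE YZ.
Qed.

Lemma det_mul_adj_col k (B : 'M[R]_k.+1) i : \det B = (B *m col i (\adj B)) i 0.
Proof.
by rewrite (expand_det_row B i) mxE; apply: eq_bigr => j _; rewrite !mxE.
Qed.

Lemma measurable_cofactor_event k m (D : 'M[R]_(k.+1, m)) (K : 'M[R]_(m, k.+1))
    i h d' (T' : measurableType d') (Z : T' -> 'M[R]_(k.+1, m)) :
  measurable_mx Z ->
  measurable [set w | `|\det ((Z w + D) *m K)| <=
    h * l2norm (K *m col i (\adj ((Z w + D) *m K)))].
Proof.
move=> mZ.
have mB : measurable_mx (fun w => (Z w + D) *m K).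
  apply: measurable_mulmx; last exact: measurable_mx_cst.
  by apply: measurable_mxD => //; exact: measurable_mx_cst.
apply: measurable_le.
  by apply: (measurableT_comp (@normr_measurable R setT)); exact: measurable_det.
apply: measurable_funM => //; apply: measurable_l2norm.
apply: measurable_mulmx; first exact: measurable_mx_cst.
by move=> a b; under eq_fun do rewrite mxE; exact: measurable_adj.
Qed.

(* Given the other rows, [K c] is fixed and the determinant is an affine form
   in the Gaussian row [i] with coefficient vector [K c]. *)
Lemma gaussian_cofactor_bound k m (D : 'M[R]_(k.+1, m)) (K : 'M[R]_(m, k.+1))
    (Z : T -> 'M[R]_(k.+1, m)) i h :
  iid_mx P Z -> (forall c : 'cV_k.+1, K *m c = 0 -> c = 0) -> 0 <= h ->
  P [set w | \det (row' i (Z w + D) *m col' ord0 K) = 0] = 0%E ->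
  (P [set w | `|\det ((Z w + D) *m K)| <=
    h * l2norm (K *m col i (\adj ((Z w + D) *m K)))]%R <=
   (2 * normal_peak 1 * h)%:E)%E.
Proof.
move=> iZ Kinj h0 null.
pose E := [set Y : 'M[R]_(k.+1, m) | `|\det ((Y + D) *m K)| <=
    h * l2norm (K *m col i (\adj ((Y + D) *m K)))].
have mE : measurable [set f : mx_space k.+1 m | E (mx_of_fam f)].
  exact: (measurable_cofactor_event D K i h (@measurable_mx_of_fam R k.+1 m)).
pose Nul := [set w | \det (row' i (Z w + D) *m col' ord0 K) = 0].
have mZ := iid_mx_measurable iZ.
have mNul : measurable Nul.
  apply: measurable_eq0; apply: measurable_det.
  apply: measurable_mulmx; last exact: measurable_mx_cst.
  move=> a b; under eq_fun do rewrite !mxE.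
  by apply: measurable_funD; [exact: mZ|exact: measurable_cst].
have c0 : (0 <= 2 * normal_peak 1 * h :> R) by rewrite !mulr_ge0 ?normal_peak_ge0.
apply: (iid_mx_row_bound (i := i) iZ mE mNul null c0) => w wN.
pose c := col i (\adj ((Z w + D) *m K)).
(* The first entry of [c] is, up to sign, the minor that is nonzero off [Nul]. *)
have cn0 : c != 0.
  apply/eqP => /colP /(_ ord0); rewrite !mxE /cofactor => /eqP.
  rewrite mulf_eq0 signr_eq0 /= => /eqP dt; apply: wN; rewrite /Nul /= -[RHS]dt.
  congr (\det _); apply/matrixP => a b.
  by rewrite !mxE; apply: eq_bigr => l _; rewrite !mxE.
pose b l := (K *m c) l 0.
(* The contribution of the shift [D] to the expansion along row [i], constant once the other rows
   are fixed. *)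
pose u := \sum_l D i l * b l.
have b0 : 0 < \sum_l b l ^+ 2.
  rewrite -sqr_l2norm exprn_gt0 // l2norm_gt0.
  by apply/eqP => /Kinj /eqP; rewrite (negbTE cn0).
have iX := iid_mx_row i iZ.
have cE w' : col i (\adj ((patch_row i (Z w') (Z w) + D) *m K)) = c.
  apply: col_adj_row'.
  by rewrite !linearD /= row'_patch_row.
have dE w' : \det ((patch_row i (Z w') (Z w) + D) *m K) =
    \sum_l b l * Z w' i l + u.
  rewrite (det_mul_adj_col _ i) cE -mulmxA mxE /u -big_split /=.
  by apply: eq_bigr => l _; rewrite !mxE eqxx /b mxE; ring.
have -> : [set w' | E (patch_row i (Z w') (Z w))] =
    [set w' | `|\sum_l b l * Z w' i l + u| <= h * Num.sqrt (\sum_l b l ^+ 2)].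
  by apply/seteqP; split=> w' /=; rewrite /E /= cE dE.
exact: (iid_linear_form_small u iX b0 h0).
Qed.

End shifted_gaussian_determinant.

(** * Almost sure invertibility and row rotations *)

Section shifted_gaussian_inverse.
Context {R : realType} d (T : measurableType d) (P : probability T R).

Lemma col'_mulmx_inj m k (K : 'M[R]_(m, k.+1)) :
  (forall c : 'cV_k.+1, K *m c = 0 -> c = 0) ->
  forall c : 'cV_k, col' ord0 K *m c = 0 -> c = 0.
Proof.
move=> Kinj c Kc0.
pose c' : 'cV[R]_k.+1 := \col_j oapp (fun j' => c j' 0) 0 (unlift ord0 j).
have /colP c'0 : c' = 0.
  apply: Kinj; rewrite -Kc0; apply/colP => i; rewrite !mxE big_ord_recl.
  rewrite !mxE unlift_none /= mulr0 add0r; apply: eq_bigr => j _.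
  by rewrite !mxE liftK.
by apply/colP => j; have := c'0 (lift ord0 j); rewrite !mxE liftK.
Qed.

Lemma iid_mx_row' m n (Z : T -> 'M[R]_(m.+1, n)) i :
  iid_mx P Z -> iid_mx P (fun w => row' i (Z w)).
Proof. by move=> iZ; exact: (iid_mx_rowsub (@lift_inj _ i) iZ). Qed.

(** Induction on [k]: the minor without the first row and column has the same form, hence is almost
    surely nonzero, and the cofactor bound with [h = 0] gives probability 0. *)
Lemma shifted_gaussian_det_neq0 k m (D : 'M[R]_(k, m)) (K : 'M[R]_(m, k))
    (Z : T -> 'M[R]_(k, m)) :
  iid_mx P Z -> (forall c : 'cV_k, K *m c = 0 -> c = 0) ->
  P [set w | \det ((Z w + D) *m K) = 0] = 0%E.
Proof.
elim: k D K Z => [|k IH] D K Z iZ Kinj.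
  rewrite (_ : [set _ | _] = set0) ?measure0 //; apply/seteqP; split=> // w /=.
  by rewrite det_mx00 => /eqP; rewrite oner_eq0.
have null : P [set w | \det (row' ord0 (Z w + D) *m col' ord0 K) = 0] = 0%E.
  rewrite -(IH (row' ord0 D) _ _ (iid_mx_row' ord0 iZ) (col'_mulmx_inj Kinj)).
  by congr (P _); apply/seteqP; split=> w /=; rewrite linearD.
apply/eqP; rewrite eq_le measure_ge0 andbT.
have := gaussian_cofactor_bound iZ Kinj (lexx 0) null.
rewrite mulr0; congr (P _ <= _)%E; apply/seteqP; split=> w /=.
  by rewrite mul0r normr_le0 => /eqP.
by move=> ->; rewrite normr0 mul0r.
Qed.

Definition givens k m (p q : 'I_k) (c s : R) (A : 'M[R]_(k, m)) : 'M[R]_(k, m) :=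
  \matrix_(i, j) (if i == p then c * A p j + s * A q j
    else if i == q then - s * A p j + c * A q j else A i j).

Lemma givens_mulmx k m n (p q : 'I_k) c s (A : 'M[R]_(k, m)) (B : 'M[R]_(m, n)) :
  givens p q c s A *m B = givens p q c s (A *m B).
Proof.
apply/matrixP => i j; rewrite !mxE; case ip: (i == p); last case iq: (i == q).
- rewrite !mulr_sumr -big_split /=; apply: eq_bigr => l _.
  by rewrite mxE ip; ring.
- rewrite !mulr_sumr -big_split /=; apply: eq_bigr => l _.
  by rewrite mxE ip iq; ring.
- by apply: eq_bigr => l _; rewrite mxE ip iq.
Qed.

Lemma givensE k m (p q : 'I_k) c s (A : 'M[R]_(k, m)) :
  givens p q c s A = givens p q c s 1%:M *m A.
Proof. by rewrite givens_mulmx mul1mx. Qed.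

Lemma givens_unit k (p q : 'I_k) c s : p != q -> c ^+ 2 + s ^+ 2 = 1 ->
  givens p q c s 1%:M \in unitmx.
Proof.
move=> pq cs1.
have /mulmx1_unit[] // : givens p q c (- s) 1%:M *m givens p q c s 1%:M = 1%:M.
rewrite -givensE; apply/matrixP => i j; rewrite !mxE !eqxx.
rewrite (eq_sym q p) (negbTE pq).
have [->|ip] := eqVneq i p; last first.
  have [->|iq //] := eqVneq i q.
  by rewrite -[RHS]mul1r -cs1; ring.
by rewrite -[RHS]mul1r -cs1; ring.
Qed.

(** The rotation acts on each column separately. In [Y n] the first [n] columns are rotated, and the
    passage to [n.+1] is one plane rotation, of the entries [(p, n)] and [(q, n)]. *)
Lemma iid_mx_givens k m (p q : 'I_k) c s (Z : T -> 'M[R]_(k, m)) :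
  p != q -> s != 0 -> c ^+ 2 + s ^+ 2 = 1 ->
  iid_mx P Z -> iid_mx P (fun w => givens p q c s (Z w)).
Proof.
move=> pq s0 cs1 iZ.
pose Y n w := \matrix_(i, j) (if (j < n)%N then givens p q c s (Z w) i j else Z w i j).
suff H n : iid_mx P (Y n).
  have := H m; rewrite /iid_mx.
  congr (iid_fam _ _ _); apply/funext => w; apply/funext => -[i j].
  by rewrite /Y mxE ltn_ord.
elim: n => [|n IH].
  move: iZ; rewrite /iid_mx; congr (iid_fam _ _ _).
  by apply/funext => w; apply/funext => -[i j]; rewrite /Y mxE.
have [nm|mn] := ltnP n m; last first.
  move: IH; rewrite /iid_mx; congr (iid_fam _ _ _).
  apply/funext => w; apply/funext => -[i j]; rewrite /Y !mxE /=.
  by rewrite !(leq_trans (ltn_ord j)) // (leq_trans mn).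
pose o := Ordinal nm.
have poqo : (p, o) != (q, o) by rewrite xpair_eqE (negbTE pq).
have := iid_fam_rot2 std_normal_rotation poqo s0 cs1 IH.
rewrite /iid_mx; congr (iid_fam _ _ _).
apply/funext => w; apply/funext => -[i j]; rewrite /rot2 /Y !mxE /= !xpair_eqE.
rewrite ltnn ltnS; have [jo|jo] := eqVneq j o.
  by rewrite !andbT jo /= leqnn ltnn.
rewrite !andbF.
have -> // : (j <= n)%N = (j < n)%N.
by rewrite leq_eqVlt; case: eqP => // jn; case/eqP: jo; apply: val_inj.
Qed.

End shifted_gaussian_inverse.

(** * The inverse applied to a fixed vector *)

Section shifted_gaussian_inverse_vector.
Context {R : realType} d (T : measurableType d) (P : probability T R).

(* [invmx B] is [B] itself for singular [B], so that case is put in explicitly. *)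
Definition inverse_event k m (K : 'M[R]_(m, k)) s (B : 'M[R]_k) (v : 'cV[R]_k) :=
  \det B = 0 \/ s <= l2norm (K *m invmx B *m v).

Lemma l2norm_invmx k m (K : 'M[R]_(m, k)) (B : 'M[R]_k) (v : 'cV[R]_k) :
  \det B != 0 ->
  l2norm (K *m invmx B *m v) = `|\det B|^-1 * l2norm (K *m \adj B *m v).
Proof.
move=> dB; rewrite /invmx unitmxE unitfE dB.
by rewrite -scalemxAr -scalemxAl l2normZ normfV.
Qed.

(** Clearing the determinant leaves the adjugate, which is measurable and fits the cofactor
    bound. *)
Lemma inverse_eventE k m (K : 'M[R]_(m, k)) s (B : 'M[R]_k) (v : 'cV[R]_k) :
  inverse_event K s B v <->
  \det B = 0 \/ s * `|\det B| <= l2norm (K *m \adj B *m v).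
Proof.
rewrite /inverse_event; have [->|dB] := eqVneq (\det B) 0; first by split; left.
by rewrite l2norm_invmx // mulrC ler_pdivlMr ?normr_gt0.
Qed.

Lemma measurable_inverse_event k m (K : 'M[R]_(m, k)) s d' (T' : measurableType d')
    (B : T' -> 'M[R]_k) (v : T' -> 'cV[R]_k) :
  measurable_mx B -> measurable_mx v ->
  measurable [set w | inverse_event K s (B w) (v w)].
Proof.
move=> mB mv.
rewrite (_ : [set _ | _] = [set w | \det (B w) = 0] `|`
  [set w | s * `|\det (B w)| <= l2norm (K *m \adj (B w) *m v w)]); last first.
  by apply/funext => w; apply/propext; exact: inverse_eventE.
have mdet := measurable_det mB.
apply: measurableU; first exact: measurable_eq0.
apply: measurable_le.
  by apply: measurable_funM => //; exact: (measurableT_comp (@normr_measurable R setT)).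
apply/measurable_l2norm/measurable_mulmx => //.
by apply: measurable_mulmx; [exact: measurable_mx_cst|exact: measurable_adj].
Qed.

Lemma givens_l2norm k (p q : 'I_k) c s (v : 'cV[R]_k) :
  p != q -> c ^+ 2 + s ^+ 2 = 1 -> l2norm (givens p q c s v) = l2norm v.
Proof.
move=> pq cs1; rewrite /l2norm; congr Num.sqrt.
have sumE (F : 'I_k -> R) : \sum_i F i =
    F p + F q + \sum_(i | (i != p) && (i != q)) F i.
  by rewrite (bigD1 p) //= (bigD1 q) ?addrA // eq_sym.
rewrite !sumE; congr (_ + _).
  rewrite !mxE !eqxx eq_sym (negbTE pq) -[RHS]mul1r -cs1.
  by ring.
by apply: eq_bigr => i /andP[/negbTE ip /negbTE iq]; rewrite mxE ip iq.
Qed.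

(** Induction on the number of nonzero coordinates of [v]. For a rotation [Q],
    [(Q B)^-1 (Q v) = B^-1 v] and [Q Z] has the law of [Z], so [v] may be rotated if [D] becomes
    [Q D]. With one coordinate left, the event lies, up to a null set, in the cofactor event with
    [h = |v| / s]. *)
Lemma shifted_gaussian_inverse_vector k m (D : 'M[R]_(k, m)) (K : 'M[R]_(m, k))
    (Z : T -> 'M[R]_(k, m)) (v : 'cV[R]_k) s :
  iid_mx P Z -> (forall c : 'cV_k, K *m c = 0 -> c = 0) -> 0 < s ->
  (P [set w | inverse_event K s ((Z w + D) *m K) v] <=
    (2 * normal_peak 1 * (l2norm v / s))%:E)%E.
Proof.
move=> iZ Kinj s0.
have [N] := ubnP #|[pred i | v i 0 != 0]|.
elim: N v D Z iZ => // N IH v D Z iZ; rewrite ltnS => leN.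
have mB (W : T -> 'M[R]_(k, m)) : measurable_mx W ->
    measurable_mx (fun w => (W w + D) *m K).
  move=> mW; apply: measurable_mulmx; last exact: measurable_mx_cst.
  by apply: measurable_mxD => //; exact: measurable_mx_cst.
have null := shifted_gaussian_det_neq0 D iZ Kinj.
have mZ := iid_mx_measurable iZ.
have mdet0 : measurable [set w | \det ((Z w + D) *m K) = 0].
  by apply/measurable_eq0/measurable_det/mB.
have [v0|v0] := eqVneq v 0.
  rewrite v0 l2norm0 mul0r mulr0 (_ : [set _ | _] =
    [set w | \det ((Z w + D) *m K) = 0]); first by rewrite null.
  apply/seteqP; split=> w /=; last by left.
  by case=> //; rewrite mulmx0 l2norm0 leNgt s0.
have [p vp] : exists p, v p 0 != 0.
  by have /cV0Pn[p vp] := v0; exists p.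
have [[q /andP[qp vq]]|Hq] := pselect (exists q, (q != p) && (v q 0 != 0)).
  have pq : p != q by rewrite eq_sym.
  (* The rotation built from [h] carries [(v p, v q)] to [(h, 0)] and so removes one nonzero
     coordinate. *)
  pose h := Num.sqrt (v p 0 ^+ 2 + v q 0 ^+ 2).
  have h2 : h ^+ 2 = v p 0 ^+ 2 + v q 0 ^+ 2.
    by rewrite sqr_sqrtr // addr_ge0 ?sqr_ge0.
  have h0 : h != 0.
    by rewrite -sqrf_eq0 h2 gt_eqF // ltr_wpDr ?sqr_ge0 // exprn_even_gt0.
  pose c := v p 0 / h; pose s' := v q 0 / h.
  have s'0 : s' != 0 by rewrite mulf_neq0 // invr_eq0.
  have cs1 : c ^+ 2 + s' ^+ 2 = 1.
    by rewrite !expr_div_n -mulrDl -h2 divff // expf_neq0.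
  pose Q : 'M[R]_k := givens p q c s' 1%:M.
  have uQ : Q \in unitmx by exact: givens_unit.
  have BE w : (givens p q c s' (Z w) + givens p q c s' D) *m K = Q *m ((Z w + D) *m K).
    by rewrite (givensE _ _ _ _ (Z w)) (givensE _ _ _ _ D) -mulmxDr mulmxA.
  have -> : [set w | inverse_event K s ((Z w + D) *m K) v] =
      [set w | inverse_event K s
        ((givens p q c s' (Z w) + givens p q c s' D) *m K) (givens p q c s' v)].
    apply/funext => w; rewrite /= BE /inverse_event det_mulmx (givensE _ _ _ _ v).
    set B := (Z w + D) *m K.
    have dQ : \det Q != 0 by rewrite -unitfE -unitmxE.
    apply/propext; have [->|dB] := eqVneq (\det B) 0.
      by rewrite mulr0; split; left.
    have uB : B \in unitmx by rewrite unitmxE unitfE.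
    have -> : K *m invmx (Q *m B) *m (Q *m v) = K *m invmx B *m v.
      have uQB : Q *m B \in unitmx by rewrite unitmx_mul uQ.
      have -> : Q *m v = Q *m B *m (invmx B *m v) by rewrite -mulmxA mulKVmx.
      by rewrite -[LHS]mulmxA mulKmx // mulmxA.
    split=> -[/eqP E|E]; [|by right| |by right]; exfalso; move: E;
      by rewrite ?mulf_eq0 (negbTE dB) ?(negbTE dQ).
  rewrite -(givens_l2norm v pq cs1); apply: IH; first exact: iid_mx_givens.
  apply: leq_trans leN; apply: proper_card; apply/properP; split.
    apply/fintype.subsetP => i; rewrite !inE mxE; case: (eqVneq i p) => [->//|_].
    case: (eqVneq i q) => // _; rewrite /c /s'.
    by rewrite (_ : _ + _ = 0) ?eqxx //; field.
  exists q; rewrite !inE // mxE eqxx (negbTE qp) negbK; apply/eqP.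
  by rewrite /c /s'; field.
case: k K D Z v IH iZ Kinj leN mB null mZ mdet0 v0 p vp Hq => [|k] K D Z v IH iZ
  Kinj leN mB null mZ mdet0 v0 p vp Hq; first by case: p vp Hq.
have vE : v = v p 0 *: delta_mx p 0.
  apply/colP => i; rewrite !mxE eqxx andbT; have [->|ip] := eqVneq i p.
    by rewrite mulr1.
  rewrite mulr0; apply/eqP/negP => /negP vi.
  by apply: Hq; exists i; rewrite ip.
have nv : l2norm v = `|v p 0|.
  rewrite /l2norm (bigD1 p) //= big1 ?addr0 ?sqrtr_sqr // => i ip.
  by rewrite vE !mxE (negbTE ip) mulr0 expr0n.
have h0 : 0 <= l2norm v / s by rewrite divr_ge0 ?l2norm_ge0 // ltW.
have null' : P [set w | \det (row' p (Z w + D) *m col' ord0 K) = 0] = 0%E.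
  rewrite -(shifted_gaussian_det_neq0 (row' p D) (iid_mx_row' p iZ)
    (col'_mulmx_inj Kinj)).
  by congr (P _); apply/seteqP; split=> w /=; rewrite linearD.
have := gaussian_cofactor_bound iZ Kinj h0 null'.
apply: le_trans.
have mcof := measurable_cofactor_event D K p (l2norm v / s) mZ.
set F := [set w | `|_| <= _] in mcof *.
pose N0 := [set w | \det ((Z w + D) *m K) = 0].
have : (P (N0 `|` F) <= P N0 + P F)%E by exact: measureU2.
rewrite {2}/N0 null add0e; apply: le_trans.
apply: le_measure; rewrite ?inE.
- by apply: measurable_inverse_event; [exact: mB|exact: measurable_mx_cst].
- exact: measurableU.
move=> w /= /inverse_eventE[|H]; [by left|].
have [dB|dB] := eqVneq (\det ((Z w + D) *m K)) 0; [by left|right].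
rewrite /F /= mulrAC ler_pdivlMr // mulrC (le_trans H) //.
by rewrite nv {1}vE -scalemxAr l2normZ -mulmxA -colE.
Qed.

End shifted_gaussian_inverse_vector.

(** * The norm of the inverse, by averaging over a Gaussian direction *)

Section shifted_gaussian_inverse_norm.
Context {R : realType} d (T : measurableType d) (P : probability T R).
Local Notation gam := (@std_normal R).

Lemma iid_second_moment (I : finType) (X : T -> I -> R) i :
  iid_fam gam P X -> (\int[P]_w (X w i ^+ 2)%:E <= 1%:E)%E.
Proof.
move=> iX; have mX : measurable_fun setT (X ^~ i : T -> measurableTypeR R) := iX.1 i.
apply: le_trans (@normal_prob_second_moment R).
have mf : measurable_fun setT (fun x : measurableTypeR R => (x ^+ 2)%:E : \bar R).
  by apply/measurable_EFinP; exact: measurable_funX.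
have f0 (x : R) : (0 <= (x ^+ 2)%:E)%E by rewrite lee_fin sqr_ge0.
rewrite -(ge0_integral_pushforward mX P (D := setT) (f := fun x => (x ^+ 2)%:E)) //.
rewrite le_eqVlt; apply/orP; left; apply/eqP.
by apply: eq_measure_integral => A mA _; exact: (iid_coord i iX).
Qed.

(** With [c] the square root of the dimension, [|X| <= c / 2 + |X|^2 / (2 c)], and the right side
    has mean at most [c]. *)
Lemma iid_expected_l2norm k (X : T -> 'I_k.+1 -> R) :
  iid_fam gam P X ->
  (\int[P]_w (l2norm (\col_i X w i))%:E <= (Num.sqrt k.+1%:R)%:E)%E.
Proof.
move=> iX; set c := Num.sqrt _.
have c0 : 0 < c by rewrite sqrtr_gt0 ltr0n.
have c2 : c ^+ 2 = k.+1%:R by rewrite sqr_sqrtr.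
have mX2 i : measurable_fun setT (fun w => (X w i ^+ 2)%:E).
  by apply/measurable_EFinP/measurable_funX; exact: iX.1.
have X20 i w : (0 <= (X w i ^+ 2)%:E)%E by rewrite lee_fin sqr_ge0.
apply: (@le_trans _ _
  (\int[P]_w ((c / 2)%:E + (2 * c)^-1%:E * \sum_i (X w i ^+ 2)%:E))%E).
  apply: ge0_le_integral => //.
  - by move=> w _; rewrite lee_fin l2norm_ge0.
  - apply/measurable_EFinP/measurable_l2norm => i j.
    by under eq_fun do rewrite mxE; exact: iX.1.
  - apply: emeasurable_funD => //; apply: emeasurable_funM => //.
    by apply: emeasurable_sum => i; exact: mX2.
  move=> w _; rewrite sumEFin -EFinM -EFinD lee_fin.
  have -> : \sum_i X w i ^+ 2 = l2norm (\col_i X w i) ^+ 2.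
    by rewrite sqr_l2norm; apply: eq_bigr => i _; rewrite mxE.
  set y := l2norm _.
  rewrite -(ler_pM2l c0) -(@ler_pM2l _ 2) //.
  have -> : 2 * (c * (c / 2 + (2 * c)^-1 * y ^+ 2)) = c ^+ 2 + y ^+ 2.
    by field; rewrite gt_eqF.
  by have := sqr_ge0 (c - y); rewrite sqrrB; lra.
rewrite ge0_integralD //; last 3 first.
- by move=> w _; rewrite lee_fin divr_ge0 // ltW.
- by move=> w _; rewrite mule_ge0 ?sume_ge0 // lee_fin invr_ge0 mulr_ge0 // ltW.
- by apply: emeasurable_funM => //; apply: emeasurable_sum => i; exact: mX2.
rewrite ge0_integralZl //; last 3 first.
- by apply: emeasurable_sum => i; exact: mX2.
- by move=> w _; rewrite sume_ge0.
- by rewrite lee_fin invr_ge0 mulr_ge0 // ltW.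
rewrite ge0_integral_sum // integral_cst //= probability_setT mule1.
apply: (@le_trans _ _ ((c / 2)%:E + (2 * c)^-1%:E * (k.+1%:R)%:E)%E).
  rewrite leeD2l // lee_wpmul2l //.
    by rewrite lee_fin invr_ge0 mulr_ge0 // ltW.
  apply: (@le_trans _ _ (\sum_(i < k.+1) 1%:E)%E).
    by apply: lee_sum => i _; exact: iid_second_moment.
  by rewrite sumEFin lee_fin sumr_const card_ord.
rewrite -c2 -EFinM -EFinD lee_fin le_eqVlt; apply/orP; left; apply/eqP.
by field; rewrite gt_eqF.
Qed.

(** The mass of [S] is computed in both orders: it is at least [p P(E)] one way and at most the
    integral of [g] the other way. *)
Lemma probability_section_averaging (E : set T) (S : set (T * T)) (p : R)
    (g : T -> R) :
  measurable E -> measurable S -> 0 <= p -> measurable_fun setT g ->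
  (forall w, E w -> (p%:E <= P (xsection S w))%E) ->
  (forall w', (P (ysection S w') <= (g w')%:E)%E) ->
  (p%:E * P E <= \int[P]_w (g w)%:E)%E.
Proof.
move=> mE mS p0 mg lower upper.
have fub : (\int[P]_w P (xsection S w) = \int[P]_w' P (ysection S w'))%E.
  have h := indic_fubini_tonelli P P mS.
  have hF := indic_fubini_tonelli_FE P mS.
  have hG := indic_fubini_tonelli_GE P mS.
  by rewrite hF hG in h; exact: h.
have mE1 : measurable_fun setT (fun w => (\1_E w)%:E : \bar R).
  by apply/measurable_EFinP; exact: measurable_indic.
have iE : (\int[P]_w (\1_E w)%:E = P E)%E by rewrite integral_indic // setIT.
apply: (@le_trans _ _ (\int[P]_w P (xsection S w))%E).
  rewrite -iE -ge0_integralZl //.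
  apply: ge0_le_integral => //.
  - by move=> w _; rewrite mule_ge0.
  - by apply: emeasurable_funM.
  - exact: measurable_fun_xsection.
  move=> w _; have [Ew|Ew] := pselect (E w).
    by rewrite indicE mem_set //= mule1; exact: lower.
  by rewrite indicE memNset //= mule0 measure_ge0.
rewrite fub; apply: ge0_le_integral => //.
- exact: measurable_fun_ysection.
- exact/measurable_EFinP.
Qed.

(** The last inequality reads [sqrt (2 / pi) / (a P(|g| >= a)) <= 2.35], the origin of the constant
    in the theorem. *)
Lemma std_normal_tail_constants : exists a p : R,
  [/\ 0 < a, 0 < p, p%:E = gam [set x : R | a <= `|x|] &
      2 * normal_peak 1 <= 235 / 100 * a * p].
Proof.
have mA : measurable [set x : R | 3 / 4 <= `|x|].
  apply: measurable_le; first exact: measurable_cst.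
  exact: (@normr_measurable R setT).
have fA : gam [set x : R | 3 / 4 <= `|x|] \is a fin_num.
  by apply: fin_num_measure; exact: mA.
have := @normal_tail R; rewrite -[normal_prob 0 1 _]/(gam _).
rewrite -(fineK fA) -EFinM lee_fin.
have k0 : 0 < 2 * normal_peak 1 :> R.
  by apply: mulr_gt0 => //; apply: normal_peak_gt0; exact: oner_neq0.
move=> kap_p; exists (3 / 4), (fine (gam [set x : R | 3 / 4 <= `|x|])); split.
- lra.
- by rewrite -(pmulr_rgt0 _ (_ : 0 < 235 / 100 * (3 / 4))); lra.
- exact: fineK fA.
- exact: kap_p.
Qed.

(* Averaging over an independent Gaussian direction [v]: whenever the inverse
   is large, [K B^-1 v] is large with probability at least P(|g| >= 3/4). *)
Lemma shifted_gaussian_inverse_average k m (D : 'M[R]_(k.+1, m))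
    (K : 'M[R]_(m, k.+1)) (Z : T -> 'M[R]_(k.+1, m)) (j : 'I_m) (E : set T) t :
  iid_mx P Z -> (forall c : 'cV_k.+1, K *m c = 0 -> c = 0) -> 0 < t ->
  measurable E ->
  (forall w, E w -> \det ((Z w + D) *m K) != 0 ->
    t < spectral_norm (K *m invmx ((Z w + D) *m K))) ->
  (P E <= (235 / 100 * Num.sqrt k.+1%:R / t)%:E)%E.
Proof.
move=> iZ Kinj t0 mE HE.
have [a [p [a0 p0 pE kap_p]]] := std_normal_tail_constants.
have : 0 < 2 * normal_peak 1 :> R.
  by apply: mulr_gt0 => //; apply: normal_peak_gt0; exact: oner_neq0.
have := shifted_gaussian_inverse_vector D _ iZ Kinj.
move: (2 * normal_peak 1) kap_p => kap kap_p vec_bound kap0.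
have [tau tauE] : exists tau, tau = a * t by exists (a * t).
have tau0 : 0 < tau by rewrite tauE mulr_gt0.
(* Any column of [Z] is a standard Gaussian vector of the right dimension; in [S] it is taken from a
   second, independent sample. *)
pose B w := (Z w + D) *m K; pose v w := col j (Z w).
have mZ := iid_mx_measurable iZ.
pose S := [set z : T * T | inverse_event K tau (B z.1) (v z.2)].
have mS : measurable S.
  apply: measurable_inverse_event.
    apply: measurable_mulmx; last exact: measurable_mx_cst.
    apply: measurable_mxD; last exact: measurable_mx_cst.
    by move=> i l; exact: (measurableT_comp (mZ i l)).
  move=> i l; under eq_fun do rewrite mxE.
  exact: (measurableT_comp (mZ i j)).
have xS w : [set w' | S (w, w')] = xsection S w.
  by apply/seteqP; split=> w'; rewrite /xsection /= inE.
have yS w' : [set w | S (w, w')] = ysection S w'.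
  by apply/seteqP; split=> w; rewrite /ysection /= inE.
have mSx w : measurable [set w' | S (w, w')].
  by rewrite xS; exact: measurable_xsection.
have mA (f : T -> R) : measurable_fun setT f -> measurable [set w | tau <= `|f w|].
  move=> mf; apply: measurable_le; first exact: measurable_cst.
  exact: (measurableT_comp (@normr_measurable R setT)).
have mgA : measurable [set x : R | a <= `|x|].
  apply: measurable_le; first exact: measurable_cst.
  exact: (@normr_measurable R setT).
have lower w : E w -> (p%:E <= P (xsection S w))%E.
  move=> Ew; rewrite -xS.
  have p_le1 : (p%:E <= 1)%E by rewrite pE; apply: probability_le1; exact: mgA.
  have [dB|dB] := eqVneq (\det (B w)) 0.
    have -> : [set w' | S (w, w')] = setT.
      apply/seteqP; split=> w' _; [exact: I|left; exact: dB].
    rewrite probability_setT; exact: p_le1.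
  (* Put [W = K B^-1]. Passing to the transpose gives a unit [z] with [y = W^T z] longer than [t].
     As [<y, v> = <z, W v> <= |W v|], a large linear form in [v] forces a large [W v]. *)
  have := HE w Ew dB; rewrite -/(B w) -spectral_norm_tr.
  move=> /(spectral_norm_gt (ltW t0)) [z z1]; set y := _ *m z => ty.
  have tb : t <= Num.sqrt (\sum_i y i 0 ^+ 2) by exact: ltW.
  rewrite pE; apply: le_trans (iid_linear_form_large (iid_mx_col j iZ) (ltW a0) t0 tb) _.
  apply: le_measure; rewrite ?inE -?tauE; [|exact: mSx|].
    apply: mA; apply: measurable_sum => i; apply: measurable_funM; last exact: mZ.
    exact: measurable_cst.
  move=> w' /= h; right; apply: le_trans h _.
  have -> : \sum_i y i 0 * Z w' i j = dotp z (K *m invmx (B w) *m v w').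
    by rewrite dotp_mulmx; apply: eq_bigr => i _; rewrite [col j _ _ _]mxE.
  by apply: le_trans (cauchy_schwarz _ _) _; rewrite z1 mul1r.
(* With the vector frozen only the matrix is random, and the fixed-vector bound applies. *)
have upper w' : (P (ysection S w') <= (kap / tau * l2norm (v w'))%:E)%E.
  rewrite -yS.
  apply: (@le_trans _ _ (kap * (l2norm (v w') / tau))%:E).
    exact: (vec_bound (v w') tau tau0).
  rewrite lee_fin mulrA mulrAC; exact: lexx.
have mv : measurable_mx v by move=> i l; under eq_fun do rewrite mxE; exact: mZ.
have kt0 : 0 <= kap / tau by rewrite divr_ge0 // ltW.
have mlv : measurable_fun setT (fun w => l2norm (v w)) by exact: measurable_l2norm.
have mg : measurable_fun setT (fun w => kap / tau * l2norm (v w)).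
  by apply: measurable_funM; first exact: measurable_cst.
have := probability_section_averaging mE mS (ltW p0) mg lower upper.
have ev : (\int[P]_w (l2norm (v w))%:E <= (Num.sqrt k.+1%:R)%:E)%E.
  apply: le_trans (iid_expected_l2norm (iid_mx_col j iZ)).
  rewrite le_eqVlt; apply/orP; left; apply/eqP; apply: eq_integral => w _.
  by congr (l2norm _)%:E; apply/colP => i; rewrite !mxE.
under eq_integral do rewrite EFinM.
rewrite ge0_integralZl; [|exact: measurableT|exact/measurable_EFinP| |by rewrite lee_fin]; last first.
  by move=> w _; rewrite lee_fin l2norm_ge0.
move=> /le_trans /(_ (lee_wpmul2l (_ : (0 <= (kap / tau)%:E)%E) ev)).
rewrite lee_fin => /(_ kt0).
have fE : P E \is a fin_num by exact: fin_num_measure.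
rewrite -(fineK fE) -!EFinM !lee_fin.
set e := fine _; set c := Num.sqrt _ => h.
have c0 : 0 <= c by exact: sqrtr_ge0.
rewrite -(ler_pM2l p0); apply: le_trans h _.
rewrite tauE.
have -> : p * (235 / 100 * c / t) = 235 / 100 * a * p / (a * t) * c.
  by field; rewrite !gt_eqF.
by rewrite ler_wpM2r // ler_wpM2r // invr_ge0 ltW // -tauE.
Qed.

End shifted_gaussian_inverse_norm.

(** * Measurability of the norm of the pseudo-inverse *)

Section measurable_pseudo_inverse.
Context {R : realType}.

Lemma rat_vector_dense n (w : 'cV[R]_n) (e : R) : 0 < e ->
  exists q : 'cV[rat]_n, l2norm (w - map_mx ratr q) <= e.
Proof.
(* The divisor [n.+1] also covers [n = 0]. *)
move=> e0; pose dlt := e / n.+1%:R.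
have d0 : 0 < dlt by rewrite divr_gt0 // ltr0n.
have H i : exists q : rat, `|w i 0 - ratr q| <= dlt.
  have [|q] := @rat_in_itvoo R (w i 0 - dlt) (w i 0); first by rewrite ltrBlDr ltrDl.
  rewrite in_itv /= => /andP[q1 q2]; exists q.
  by rewrite ger0_norm ?subr_ge0 ?ltW //; lra.
have [f fH] := choice H.
exists (\col_i f i); apply: le_trans (ler_l2norm_sum _) _.
apply: (@le_trans _ _ (\sum_(i < n) dlt)).
  by apply: ler_sum => i _; rewrite !mxE; exact: fH.
rewrite sumr_const card_ord -mulr_natr /dlt mulrAC ler_pdivrMr ?ltr0n //.
by rewrite ler_wpM2l ?(ltW e0) // ler_nat.
Qed.

(** Both sides are continuous in the vector and rational vectors are dense. A countable family of
    conditions makes the sublevel sets measurable. *)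
Lemma spectral_norm_mpinv_le_rat m n (A : 'M[R]_(m, n)) t : 0 <= t ->
  (spectral_norm (mpinv A) <= t) <->
  (forall q : 'cV[rat]_m, l2norm (A^T *m map_mx ratr q) <=
    t * l2norm (A *m (A^T *m map_mx ratr q))).
Proof.
move=> t0; split=> [/(spectral_norm_mpinv_le _ t0) H q //|H].
apply/(spectral_norm_mpinv_le _ t0) => w.
apply/ler_addgt0Pr => e e0.
pose a := spectral_norm A^T; pose b := spectral_norm (A *m A^T).
have a0 : 0 <= a := spectral_norm_ge0 _.
have b0 : 0 <= b := spectral_norm_ge0 _.
have tb0 : 0 <= t * b by rewrite mulr_ge0.
(* An approximation error [dlt] costs [(a + t b) dlt] in total; the added 1 keeps the divisor
   positive. *)
have c0 : 0 < a + t * b + 1 by lra.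
have [q qw] := rat_vector_dense w (divr_gt0 e0 c0).
set v := map_mx ratr q in qw *; have Hv := H q; rewrite -/v in Hv.
set dlt := e / _ in qw.
have d0 : 0 <= dlt by rewrite divr_ge0 // ltW.
have h1 : l2norm (A^T *m w) <= l2norm (A^T *m v) + a * dlt.
  rewrite -[in leLHS](subrK v w) addrC mulmxDr (le_trans (ler_l2normD _ _)) //.
  by rewrite lerD2l (le_trans (ler_l2norm_mul _ _)) // ler_wpM2l.
have h2 : l2norm (A *m (A^T *m v)) <= l2norm (A *m (A^T *m w)) + b * dlt.
  rewrite !mulmxA; have -> : v = w - (w - v) by rewrite opprB addrC subrK.
  rewrite mulmxBr (le_trans (ler_l2normD _ _)) // lerD2l.
  have -> : - (A *m A^T *m (w - v)) = A *m A^T *m (- (w - v)) by rewrite mulmxN.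
  rewrite (le_trans (ler_l2norm_mul _ _)) // ler_wpM2l //.
  by rewrite -scaleN1r l2normZ normrN normr1 mul1r.
have h3 := ler_wpM2l t0 h2.
have dE : (a + t * b + 1) * dlt = e by rewrite mulrC divfK // gt_eqF.
by nra.
Qed.

Lemma measurable_spectral_norm_mpinv d (T : measurableType d) m n
    (A : T -> 'M[R]_(m, n)) :
  measurable_mx A -> measurable_fun setT (fun w => spectral_norm (mpinv (A w))).
Proof.
move=> mA.
have mle t : measurable [set w | spectral_norm (mpinv (A w)) <= t].
  have [t0|t0] := leP 0 t; last first.
    rewrite (_ : [set _ | _] = set0) //; apply/seteqP; split=> // w /=.
    by rewrite leNgt (lt_le_trans t0) // spectral_norm_ge0.
  rewrite (_ : [set _ | _] = \bigcap_(q in [set: 'cV[rat]_m])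
    [set w | l2norm ((A w)^T *m map_mx ratr q) <=
      t * l2norm (A w *m ((A w)^T *m map_mx ratr q))]); last first.
    apply/seteqP; split=> w /=.
      by move=> /(spectral_norm_mpinv_le_rat _ t0) H q _; exact: H.
    by move=> H; apply/(spectral_norm_mpinv_le_rat _ t0) => q; exact: H.
  rewrite -[X in measurable X]setCK setC_bigcap; apply: measurableC.
  apply: countable_bigcupT_measurable; first exact: countableP.
  move=> q; apply: measurableC.
  have mAq : measurable_mx (fun w => (A w)^T *m map_mx ratr q).
    by apply: measurable_mulmx; [exact: measurable_trmx|exact: measurable_mx_cst].
  apply: measurable_le; first exact: measurable_l2norm.
  apply: measurable_funM; first exact: measurable_cst.
  by apply: measurable_l2norm; exact: measurable_mulmx.
move=> mT; apply: (measurability _ (RGenOInfty.measurableE R)) => //.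
move=> _ [_ [x ->] <-]; rewrite setTI.
rewrite (_ : _ @^-1` _ = ~` [set w | spectral_norm (mpinv (A w)) <= x]).
  exact: measurableC.
apply/seteqP; split=> w /=; rewrite in_itv /= andbT ltNge.
  by move/negP.
by move=> h; apply/negP.
Qed.

End measurable_pseudo_inverse.

(** * The norm of the pseudo-inverse of a Gaussian product *)

Section gaussian_mulmx.
Context {R : realType} d (T : measurableType d) (P : probability T R).

Lemma spectral_normZ_le m n (c : R) (A : 'M[R]_(m, n)) :
  spectral_norm (c *: A) <= `|c| * spectral_norm A.
Proof.
apply: spectral_norm_le => [|v]; first by rewrite mulr_ge0 ?spectral_norm_ge0.
by rewrite -scalemxAl l2normZ -mulrA ler_wpM2l // ler_l2norm_mul.
Qed.

Lemma mpinv_eq0 m n (A : 'M[R]_(m, n)) : (mpinv A == 0) = (A == 0).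
Proof.
have [h1 h2 _ _] := mpinvP A; apply/eqP/eqP => A0.
  by rewrite -h1 A0 mulmx0 mul0mx.
by rewrite -h2 A0 mulmx0 mul0mx.
Qed.

Lemma gaussian_mx_standardize mu sigma m n (G : 'M[{RV P >-> R}]_(m, n)) :
  0 < sigma -> gaussian_mx mu sigma G ->
  iid_mx P (fun w => \matrix_(i, j) ((G i j w - mu) / sigma)).
Proof.
move=> s0 [gG iG].
have mS (A : set R) : measurable A -> measurable [set x : R | A ((x - mu) / sigma)].
  move=> mA.
  have mf : measurable_fun setT (fun x : R => (x - mu) / sigma).
    by apply: measurable_funM => //; exact: measurable_funB.
  by rewrite -[X in measurable X]setTI; exact: mf.
split=> [[i j]|A mA].
  have -> : (fun w => (\matrix_(a, b) ((G a b w - mu) / sigma)) i j) =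
      (fun w => (G i j w - mu) / sigma) by apply/funext => w; rewrite mxE.
  by apply: measurable_funM => //; apply: measurable_funB.
pose A' p := [set x : R | A p ((x - mu) / sigma)].
have mA' p : measurable (A' p) by exact: mS.
have := iG [set: 'I_m * 'I_n]%SET A' mA'.
rewrite (_ : \bigcap_(p in _) _ = [set w | forall p : 'I_m * 'I_n,
  A p ((\matrix_(i, j) ((G i j w - mu) / sigma)) p.1 p.2)]); last first.
  apply/seteqP; split=> w /= H p; last by move=> _; have := H p; rewrite mxE.
  by rewrite mxE; apply: (H p); rewrite /= inE.
move=> E; apply: (etrans E); apply: eq_big => [p|p _]; first by rewrite inE.
apply: (etrans (gG p.1 p.2 _ (mA' p))).
exact: normal_prob_standardize.
Qed.

Lemma measurable_sample_mx m n (G : 'M[{RV P >-> R}]_(m, n)) :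
  measurable_mx (sample_mx G).
Proof. by move=> i j; under eq_fun do rewrite mxE; exact: measurable_funPT. Qed.

Section reduction.
Variables (mu sigma : R) (m n r : nat) (G' : 'M[{RV P >-> R}]_(r, m)).
Variables (M : 'M[R]_(m, n)) (U : 'M[R]_(r, m)).
Hypotheses (s0 : 0 < sigma) (m0 : (0 < m)%N) (r0 : (0 < r)%N).
Hypotheses (gG : gaussian_mx mu sigma G') (M0 : M != 0).

Let N w := spectral_norm (mpinv ((sample_mx G' w + U) *m M)).

Lemma measurable_norm_mpinv_mulmx : measurable_fun setT N.
Proof.
apply: measurable_spectral_norm_mpinv.
apply: measurable_mulmx; last exact: measurable_mx_cst.
by apply: measurable_mxD; [exact: measurable_sample_mx|exact: measurable_mx_cst].
Qed.

(** [Z] consists of the first [k.+1] standardized rows of [G'], [D] absorbs the mean and [U], and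
    [K = M L]. The selected rows of [G] are then [sigma (Z + D)], whence the division by [sigma]. *)
Lemma compressed_gaussian : exists (k : nat) (D : 'M[R]_(k.+1, m))
    (K : 'M[R]_(m, k.+1)) (Z : T -> 'M[R]_(k.+1, m)),
  [/\ minn r (\rank M) = k.+1, iid_mx P Z,
    forall c : 'cV_k.+1, K *m c = 0 -> c = 0
    & forall w, \det ((Z w + D) *m K) != 0 -> N w != 0 /\
      N w <= spectral_norm (mpinv M) *
        (spectral_norm (K *m invmx ((Z w + D) *m K)) / sigma)].
Proof.
have [L [X [LE hc Kinj]]] := row_space_compression r M.
have k_gt0 : (0 < minn r (\rank M))%N by rewrite leq_min r0 lt0n mxrank_eq0.
have k_r : (minn r (\rank M) <= r)%N by exact: geq_minl.
move: (minn r (\rank M)) k_gt0 k_r L X LE hc Kinj => [//|k] _ k_r L X LE hc Kinj.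
pose Z0 w := \matrix_(i, j) ((G' i j w - mu) / sigma).
pose Z w : 'M[R]_(k.+1, m) := \matrix_(i, j) Z0 w (widen_ord k_r i) j.
pose D : 'M[R]_(k.+1, m) := \matrix_(i, j) ((mu + U (widen_ord k_r i) j) / sigma).
have sn0 : sigma != 0 by rewrite gt_eqF.
exists k, D, (M *m L), Z; split=> // [|w dB].
  apply: iid_mx_rowsub; last exact: gaussian_mx_standardize.
  by move=> i i' /(congr1 val) /= /val_inj.
set B := _ *m _ in dB *.
have SE : pid_mx k.+1 *m (sample_mx G' w + U) = sigma *: (Z w + D).
  apply/matrixP => i j; rewrite (mul_pid_mx_l k_r) !mxE; field.
  exact: sn0.
have BE : pid_mx k.+1 *m (sample_mx G' w + U) *m (M *m L) = sigma *: B.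
  by rewrite SE scalemxAl.
have usB : sigma *: B \in unitmx.
  by rewrite unitmxE unitfE detZ mulf_neq0 // expf_neq0.
split.
  (* A zero pseudo-inverse forces [G M = 0], hence a zero compression, against the invertibility of
     [sigma *: B]. *)
  rewrite spectral_norm_eq0 mpinv_eq0; apply/eqP => GM0.
  move: usB; rewrite -BE -mulmxA (mulmxA _ M) GM0 mul0mx mulmx0.
  by rewrite unitmxE det0 unitr0.
apply: le_trans (spectral_norm_mpinv_mulmx LE _ hc _) _.
- by move=> y; exact: l2norm_pid_mx.
- by rewrite BE.
rewrite BE ler_wpM2l ?spectral_norm_ge0 // invmxZ //.
rewrite -scalemxAr (le_trans (spectral_normZ_le _ _)) //.
by rewrite normfV gtr0_norm // mulrC.
Qed.

Let rhat := minn r (\rank M).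

Lemma norm_mpinv_mulmx_neq0 : P [set w | N w = 0] = 0%E.
Proof.
have [k [D [K [Z [_ iZ Kinj H]]]]] := compressed_gaussian.
apply/eqP; rewrite eq_le measure_ge0 andbT.
rewrite -(shifted_gaussian_det_neq0 D iZ Kinj).
apply: le_measure; rewrite ?inE.
- exact: measurable_eq0 measurable_norm_mpinv_mulmx.
- apply: measurable_eq0; apply: measurable_det; apply: measurable_mulmx.
    apply: measurable_mxD; last exact: measurable_mx_cst.
    exact: iid_mx_measurable iZ.
  exact: measurable_mx_cst.
move=> w /= Nw; apply/eqP/negP => /negP /H[].
by rewrite Nw eqxx.
Qed.

(** The averaging bound asks for a strict inequality, so it is applied to every [t' < t] before
    passing to the limit. Points of [E] with [N w = 0] are allowed: as [1 / 0 = 0], they belong to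
    the events of the distribution function. *)
Lemma norm_mpinv_mulmx_large (E : set T) tau : 0 < tau -> measurable E ->
  (forall w, E w -> N w != 0 -> tau <= N w) ->
  (P E <= (235 / 100 * Num.sqrt rhat%:R * spectral_norm (mpinv M) /
    (sigma * tau))%:E)%E.
Proof.
move=> tau0 mE HE.
have [k [D [K [Z [kE iZ Kinj H]]]]] := compressed_gaussian.
rewrite /rhat kE; set c := Num.sqrt _; set b := spectral_norm _.
have b0 : 0 < b by rewrite lt0r spectral_norm_ge0 spectral_norm_eq0 mpinv_eq0 M0.
have c0 : 0 <= c by exact: sqrtr_ge0.
pose t := tau * sigma / b.
have t0 : 0 < t by rewrite divr_gt0 // mulr_gt0.
have bound t' : 0 < t' -> t' < t -> (P E <= (235 / 100 * c / t')%:E)%E.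
  move=> t'0 t't.
  apply: (shifted_gaussian_inverse_average (Ordinal m0) iZ Kinj t'0 mE) => w Ew dB.
  have [Nw0 NW] := H w dB; apply: lt_le_trans t't _.
  have := le_trans (HE w Ew Nw0) NW.
  by rewrite /t ler_pdivrMr // mulrA ler_pdivlMr // mulrC (mulrC b).
have fE : P E \is a fin_num by exact: fin_num_measure.
rewrite -(fineK fE) in bound *; set e := fine _ in bound *.
rewrite lee_fin leNgt; apply/negP => lt_e.
have rE : 235 / 100 * c * b / (sigma * tau) = 235 / 100 * c / t.
  by rewrite /t; field; rewrite !gt_eqF.
rewrite rE in lt_e.
have C0 : 0 <= 235 / 100 * c by apply: mulr_ge0 c0; lra.
have e0 : 0 < e by apply: le_lt_trans lt_e; rewrite divr_ge0 // ltW.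
rewrite (ltr_pdivrMr _ _ t0) in lt_e.
(* If [e] exceeded the bound, then [q < t], and the estimate at the midpoint of [q] and [t] would
   place that midpoint at most at [q]. *)
pose q := 235 / 100 * c / e.
have qt : q < t by rewrite /q ltr_pdivrMr // [ltRHS]mulrC.
have q0 : 0 <= q by rewrite divr_ge0 // ltW.
have qe : 235 / 100 * c = q * e by rewrite /q divfK // gt_eqF.
have l0 : 0 < (q + t) / 2 by lra.
have lt : (q + t) / 2 < t by lra.
have := bound _ l0 lt.
rewrite lee_fin (ler_pdivlMr _ _ l0) qe mulrC (ler_pM2r e0) => h.
lra.
Qed.

Lemma norm_mpinv_mulmx_tail x y : 0 < x -> 0 <= y ->
  let F t := 235 / 100 * t * Num.sqrt rhat%:R * spectral_norm (mpinv M) / sigma in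
  ((cdf_fun P (fun w => (1 / N w)%R) y <= (F y)%:E)%E) /\
  ((P [set w | (F x <= N w)%R] <= (1 / x)%:E)%E).
Proof.
move=> x0 y0 F.
have mN := measurable_norm_mpinv_mulmx.
have N0 w : 0 <= N w by exact: spectral_norm_ge0.
have b0 : 0 < spectral_norm (mpinv M).
  by rewrite lt0r spectral_norm_ge0 spectral_norm_eq0 mpinv_eq0 M0.
have c0 : 0 < Num.sqrt rhat%:R :> R.
  by rewrite sqrtr_gt0 ltr0n leq_min r0 lt0n mxrank_eq0.
split; last first.
  have F0 : 0 < F x.
    apply: divr_gt0 s0; apply: mulr_gt0 b0; apply: mulr_gt0 c0.
    by apply: mulr_gt0 x0; lra.
  apply: le_trans (norm_mpinv_mulmx_large F0 _ _) _; last 2 first.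
  - by move=> w /=.
  - rewrite lee_fin le_eqVlt; apply/orP; left; apply/eqP; rewrite /F.
    by field; rewrite !gt_eqF.
  by apply: measurable_le => //; exact: measurable_cst.
(* For [y = 0] the event is exactly [N w = 0], because [1 / 0 = 0]; it is a null set. *)
rewrite /cdf_fun; move: y0; rewrite le_eqVlt => /predU1P[<-|y0].
  rewrite (_ : _ @^-1` _ = [set w | N w = 0]).
    by rewrite norm_mpinv_mulmx_neq0 lee_fin /F mulr0 !mul0r.
  apply/seteqP; split=> w /=; rewrite in_itv /= div1r; last by move=> ->; rewrite invr0.
  by rewrite invr_le0 => Nw; apply/eqP; rewrite eq_le Nw N0.
have iy0 : 0 < y^-1 by rewrite invr_gt0.
apply: le_trans (norm_mpinv_mulmx_large iy0 _ _) _; last 2 first.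
- move=> w /=; rewrite in_itv /= div1r => h Nw.
  by rewrite -[N w]invrK lef_pV2 ?posrE ?invr_gt0 // lt0r Nw N0.
- rewrite lee_fin le_eqVlt; apply/orP; left; apply/eqP; rewrite /F.
  by field; rewrite !gt_eqF.
rewrite (_ : _ @^-1` _ = [set w | N w = 0] `|` [set w | y^-1 <= N w]).
  by apply: measurableU; [exact: measurable_eq0|apply: measurable_le => //; exact: measurable_cst].
apply/seteqP; split=> w /=; rewrite in_itv /= div1r.
  have [->|Nw] := eqVneq (N w) 0; first by left.
  by right; rewrite -[N w]invrK lef_pV2 ?posrE ?invr_gt0 // lt0r Nw N0.
case=> [->|h]; first by rewrite invr0 ltW.
by rewrite -[y]invrK lef_pV2 ?posrE // (lt_le_trans iy0).
Qed.

End reduction.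

Lemma gaussian_mx_tr mu sigma m n (G : 'M[{RV P >-> R}]_(m, n)) :
  gaussian_mx mu sigma G -> gaussian_mx mu sigma G^T.
Proof.
move=> [gG iG]; split=> [i j|J A mA]; first by rewrite mxE; exact: gG.
pose sw (p : 'I_n * 'I_m) := (p.2, p.1); pose sw' (p : 'I_m * 'I_n) := (p.2, p.1).
have swK : cancel sw sw' by case.
have swK' : cancel sw' sw by case.
have := iG (sw @: J)%SET (fun p => A (sw' p)) (fun p => mA _).
rewrite big_imset /=; last by move=> p q _ _; exact: can_inj swK _ _.
rewrite (_ : \bigcap_(p in _) _ =
    \bigcap_(p in [set` J]) ((fun p => G^T p.1 p.2) p @^-1` A p)).
  move=> ->; apply: eq_bigr => -[i j] _ /=.
  by rewrite mxE.
apply/seteqP; split=> w /= H.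
  move=> p pJ /=; have := H (sw p); rewrite /= swK mxE; apply.
  by rewrite /= imset_f.
move=> p /= /imsetP[q qJ ->]; rewrite swK.
by have := H q qJ; rewrite /= mxE.
Qed.

End gaussian_mulmx.

Theorem theorem4p1 (R : realType) (d : measure_display) (T : measurableType d)
    (P : probability T R) (mu sigma : R) (m n r : nat)
    (G' : 'M[{RV P >-> R}]_(r, m)) (H' : 'M[{RV P >-> R}]_(n, r))
    (M : 'M[R]_(m, n)) (U : 'M[R]_(r, m)) (V : 'M[R]_(n, r)) (x y : R) :
  0 < sigma -> (0 < m)%N -> (0 < n)%N -> (0 < r)%N ->
  gaussian_mx mu sigma G' -> gaussian_mx mu sigma H' ->
  M != 0 -> 0 < x -> 0 <= y ->
  let GM := fun w : T => (sample_mx G' w + U) *m M in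
  let MH := fun w : T => M *m (sample_mx H' w + V) in
  let rhat := minn r (\rank M) in
  let F := fun t : R =>
    235 / 100 * t * Num.sqrt rhat%:R * spectral_norm (mpinv M) / sigma in
  [/\ (cdf_fun P (fun w => (1 / spectral_norm (mpinv (GM w)))%R) y <= (F y)%:E)%E,
      (cdf_fun P (fun w => (1 / spectral_norm (mpinv (MH w)))%R) y <= (F y)%:E)%E,
      (P [set w | (F x <= spectral_norm (mpinv (GM w)))%R] <= (1 / x)%:E)%E
    & (P [set w | (F x <= spectral_norm (mpinv (MH w)))%R] <= (1 / x)%:E)%E].
Proof.
move=> s0 m0 n0 r0 gG gH M0 x0 y0 GM MH rhat F.
have [G1 G2] := norm_mpinv_mulmx_tail U s0 m0 r0 gG M0 x0 y0.
(* As [(M H)^T = H^T M^T] and transposition preserves Gaussian matrices, the rank and the norm of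
   the pseudo-inverse, the second product is an instance of the first. *)
have MT0 : M^T != 0 by rewrite trmx_eq0.
have [H1 H2] := norm_mpinv_mulmx_tail V^T s0 n0 r0 (gaussian_mx_tr gH) MT0 x0 y0.
have NE w : spectral_norm (mpinv ((sample_mx H'^T w + V^T) *m M^T)) =
    spectral_norm (mpinv (MH w)).
  have -> : sample_mx H'^T w + V^T = (sample_mx H' w + V)^T.
    by apply/matrixP => i j; rewrite !mxE.
  by rewrite -trmx_mul mpinv_tr spectral_norm_tr.
have nE : spectral_norm (mpinv M^T) = spectral_norm (mpinv M).
  by rewrite mpinv_tr spectral_norm_tr.
rewrite mxrank_tr nE in H1 H2.
split=> //.
  by move: H1; under eq_fun do rewrite NE.
by move: H2; under eq_set do rewrite NE.
Qed.
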